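(* Let $p$ and $l$ be odd rational primes such that the multiplicative order $f = \mathrm{ord}\,p \pmod{l}$ of $p$ modulo $l$ is defined and even. Let $s \geq 1$ be an integer and let $q = p^{fs}$, so that $q \equiv 1 \pmod{2l}$. Put $q_0 = p^f$ and $u = \sqrt{q_0}$, so that $u$ is an integer, $q = q_0^s$ and $\sqrt{q} = u^s$. Let $a,b,c \in \mathbf{F}_q$ with $abc \neq 0$, and let $C$ be the (non-singular) projective plane curve $aY^{2l} = bX^{2l} + cZ^{2l}$ over $\mathbf{F}_q$. Fix a generator $\gamma$ of $\mathbf{F}_q^*$ and let $i,j$ be integers with $\mathrm{ind}_{\gamma}(b/c) \equiv i \pmod{2l}$ and $\mathrm{ind}_{\gamma}(a/c) \equiv j \pmod{2l}$. Let $K_s$ be the function field of $C/\mathbf{F}_q$ and $h_s$ its class number. Then $h_s = h_{\mathrm{odd}}$ if $s$ is odd and $h_s = h_{\mathrm{even}}$ if $s$ is even, where $h_{\mathrm{odd}}$ and $h_{\mathrm{even}}$ are given as follows. 1. If $i \equiv j \equiv 0 \pmod{2l}$: $$h_{\mathrm{odd}} = (u^s + 1)^{(2l-1)(2l-2)}, \quad h_{\mathrm{even}} = (u^s - 1)^{(2l-1)(2l-2)}.$$ 2. If $i,j \equiv 0 \pmod 2$ and $i,\ j,\ i-j \not\equiv 0 \pmod{2l}$: $$h_{\mathrm{odd}} = (u^s + 1)^2 (u^{ls} + 1)^{4l-6}, \quad h_{\mathrm{even}} = (u^s - 1)^2 (u^{ls} - 1)^{4l-6}.$$ 3. If $i,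 j \equiv 0 \pmod 2$ and one of the following holds: (i) $i \equiv 0,\ j \not\equiv 0 \pmod{2l}$; (ii) $i \not\equiv 0,\ j \equiv 0 \pmod{2l}$; (iii) $i,j \not\equiv 0,\ i \equiv j \pmod{2l}$: $$h_{\mathrm{odd}} = \frac{(u^{ls} + 1)^{4l-4}}{(u^s + 1)^{2l-2}}, \quad h_{\mathrm{even}} = \frac{(u^{ls} - 1)^{4l-4}}{(u^s - 1)^{2l-2}}.$$ 4. If one of the following holds: (i) $i \equiv 0,\ j \equiv l \pmod{2l}$; (ii) $i \equiv l,\ j \equiv 0 \pmod{2l}$; (iii) $i \equiv j \equiv l \pmod{2l}$: $$h_{\mathrm{odd}} = (u^s + 1)^{2(l-1)^2} (u^s - 1)^{2l(l-1)}, \quad h_{\mathrm{even}} = (u^s - 1)^{2(l-1)^2} (u^s + 1)^{2l(l-1)}.$$ 5. If one of the following holds: (i) $j \not\equiv 0 \pmod 2$, $i \equiv 0,\ j \not\equiv l \pmod{2l}$; (ii) $i \not\equiv 0 \pmod 2$, $i \not\equiv l,\ j \equiv 0 \pmod{2l}$; (iii) $i \not\equiv 0 \pmod 2$, $i \equiv j,\ i \not\equiv l \pmod{2l}$: $$h_{\mathrm{odd}} = \left(\frac{u^{2ls} - 1}{u^s + 1}\right)^{2l-2}, \quad h_{\mathrm{even}} = \left(\frac{u^{2ls} -1}{u^s - 1}\right)^{2l-2}.$$ 6. If $i,\ j,\ i-j \not\equiv 0, l \pmod{2l}$ and one of the following holds: (i) $i \not\equiv j \pmod 2$; (ii) $i,j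 \not\equiv 0 \pmod 2$: $$h_{\mathrm{odd}} = (u^s + 1)^2 (u^{ls} + 1)^{2l-4} (u^{ls} -1)^{2l-2}, \quad h_{\mathrm{even}} = (u^s -1)^2 (u^{ls} - 1)^{2l-4} (u^{ls} + 1)^{2l-2}.$$ 7. If one of the following holds: (i) $i \equiv l,\ j \not\equiv 0,l \pmod{2l}$; (ii) $i \not\equiv 0,l,\ j \equiv l \pmod{2l}$; (iii) $i,j \not\equiv 0,l,\ i-j \equiv l \pmod{2l}$: $$h_{\mathrm{odd}} = \frac{(u^{ls} + 1)^{2l-3} (u^{ls} - 1)^{2l-1}}{(u^s + 1)^{l-2} (u^s - 1)^{l}}, \quad h_{\mathrm{even}} = \frac{(u^{ls} - 1)^{2l-3} (u^{ls} + 1)^{2l-1}}{(u^s - 1)^{l-2} (u^s + 1)^{l}}.$$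
   Context: For coprime $p$ and $l$, $\mathrm{ord}\,p\pmod l$ is the least positive integer $f$ with $p^f \equiv 1 \pmod l$. For a generator $\gamma$ of $\mathbf{F}_q^*$ and $x \in \mathbf{F}_q^*$, $\mathrm{ind}_\gamma(x)$ denotes an integer $k$ (well defined modulo $q-1$) with $\gamma^k = x$. A condition such as ''$x \not\equiv 0,l \pmod{2l}$'' means $x\not\equiv 0$ and $x \not\equiv l \pmod{2l}$. The class number of the function field of a non-singular projective curve over $\mathbf{F}_q$ is the order of its group of degree-zero divisor classes over $\mathbf{F}_q$; equivalently it is $P(1)$, where $P(t)$ is the numerator of the zeta function $\exp\left(\sum_{n\ge1} \#C(\mathbf{F}_{q^n})\,t^n/n\right) = P(t)/((1-t)(1-qt))$ of the curve $C/\mathbf{F}_q$. *)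

(* Defs.v *)
From HB Require Import structures.
From mathcomp Require Import all_boot all_order all_algebra all_fingroup.
From mathcomp Require Import all_solvable all_field.

Set Implicit Arguments.
Unset Strict Implicit.
Unset Printing Implicit Defensive.

Import Order.TTheory GRing.Theory Num.Theory.
Local Open Scope ring_scope.

Definition is_ord (p l f : nat) : Prop :=
  [/\ coprime p l, (0 < f)%N, (p ^ f = 1 %[mod l])%N
    & forall k, (0 < k)%N -> (p ^ k = 1 %[mod l])%N -> (f <= k)%N].

(* ind_g(x) = i modulo m; x is nonzero since g is a unit.  This does not depend
   on the choice of the index k as soon as m divides #|F| - 1. *)
Definition ind_mod (F : finFieldType) (g : {unit F}) (x : F) (m i : int) : Prop :=
  exists2 k : int, (val g : F) ^ k = x & (k = i %[mod m])%Z.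

Section Extension.

Variable F : finFieldType.

Definition ext_poly (n : nat) : {poly F} := 'X^(#|F| ^ n.-1.+1) - 'X.

Lemma ext_poly_neq0 n : ext_poly n != 0.
Proof.
have lt1: (1 < #|F| ^ n.-1.+1)%N.
  by rewrite -[1%N](exp1n n.-1.+1) ltn_exp2r // finNzRing_gt1.
by rewrite -size_poly_gt0 size_polyDl size_polyXn // size_polyN size_polyX.
Qed.

(* The extension of degree n of F, for n > 0 (for n = 0 this is F itself): the
   splitting field of X^(#|F|^n) - X; see dim_ext_field and card_ext_field. *)
Definition ext_field (n : nat) : splittingFieldType F :=
  sval (FinSplittingFieldFor (ext_poly_neq0 n)).

Lemma card_ext_field n :
  (0 < n)%N -> #|finvect_type (ext_field n)| = (#|F| ^ n)%N.
Proof.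
move=> n_gt0; rewrite /ext_field; case: FinSplittingFieldFor => L /=.
rewrite /ext_poly prednK //; set m := (_ ^ n)%N.
have m_gt1: (1 < m)%N by rewrite -[1%N](exp1n n) ltn_exp2r // finNzRing_gt1.
have m_gt0 := ltnW m_gt1; have m1_gt0: (0 < m.-1)%N by rewrite -ltnS prednK.
pose q (R : nzRingType) : {poly R} := 'X^m - 'X.
have Dq (R : nzRingType) : q R = ('X^(m.-1) - 1) * ('X - 0).
  by rewrite subr0 mulrBl mul1r -exprSr prednK.
rewrite rmorphB rmorphXn /= map_polyX -/(q L) => -[zs DqL defL].
have [p p_pr pcharF] := finPcharP F.
have pcharL: p \in [pchar L] by rewrite pchar_lalg.
have p_m: (p %| m)%N.
  have cF := card_pprimeChar pcharF.
  rewrite /m {1}cF -expnM; apply: dvdn_exp => //.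
  rewrite muln_gt0 n_gt0 andbT lt0n; apply/eqP=> z.
  by have := finNzRing_gt1 F; rewrite cF z.
have [/= a _ Da] := finField_galois_generator (sub1v {:L}).
pose Em := fixedSpace (a ^+ n)%g; rewrite /= dimv1 expn1 in Da.
have Uzs: uniq zs.
  rewrite -separable_prod_XsubC -(eqp_separable DqL) Dq separable_root andbC.
  rewrite /root !hornerE subr_eq0 eq_sym expr0n gtn_eqF ?oner_eq0 //=.
  rewrite cyclotomic.separable_Xn_sub_1 // -subn1 natrB // subr_eq0.
  rewrite -(divnK p_m) natrM (pcharf0 pcharL) mulr0.
  by rewrite eq_sym oner_eq0.
have in_zs: zs =i Em.
  move=> z; rewrite -root_prod_XsubC -(eqp_root DqL) (sameP fixedSpaceP eqP).
  rewrite /root !hornerE subr_eq0 /= /m; congr (_ == z).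
  elim: (n) => [|i IHi]; first by rewrite gal_id.
  by rewrite expgSr expnSr exprM IHi galM ?Da ?memvf.
have defEm: Em = {:L}%VS.
  apply/eqP; rewrite eqEsubv subvf -defL -[Em]subfield_closed agenvS //.
  by rewrite subv_add sub1v; apply/span_subvP=> z; rewrite in_zs.
have Fmzs: finvect_type L =i zs by move=> z; rewrite in_zs defEm memvf.
rewrite (eq_card Fmzs).
apply: succn_inj; rewrite (card_uniqP _) //= -(size_prod_XsubC _ id).
by rewrite -(eqp_size DqL) size_polyDl size_polyXn // size_polyN size_polyX.
Qed.

Lemma dim_ext_field n : (0 < n)%N -> \dim {: ext_field n} = n.
Proof.
move=> n_gt0; have := card_ext_field n_gt0.
have := card_vspace {: finvect_type (ext_field n)}; rewrite card_vspacef => ->.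
by move/eqP; rewrite eqn_exp2l ?finNzRing_gt1 // => /eqP.
Qed.

End Extension.

(* The projective plane curve a Y^m = b X^m + c Z^m over F, which is
   non-singular when a b c m != 0 in F. *)
Section Curve.

Variables (F : finFieldType) (a b c : F) (m : nat).

Section Points.

Variable L : fieldExtType F.
Local Notation L3 := 'rV[finvect_type L]_3.

Definition on_curve (v : L3) : bool :=
  let X : L := v 0 0 in let Y : L := v 0 1 in let Z : L := v 0 2%:R in
  a%:A * Y ^+ m == b%:A * X ^+ m + c%:A * Z ^+ m.

(* A point of the projective plane over L is represented by the set of all
   its homogeneous coordinate vectors. *)
Definition proj_point (v : L3) : {set L3} :=
  [set k *: v | k : finvect_type L & k != 0].

Definition curve_points : {set {set L3}} :=
  [set proj_point v | v : L3 & (v != 0) && on_curve v].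

End Points.

Definition num_points (n : nat) : nat := #|curve_points (ext_field F n)|.

(* Formal power series over rat are represented by their coefficient
   sequences.  For f with f 0 = 0, the coefficient of t^n in
   exp f = \sum_k f^k / k! only involves k <= n and f modulo t^(n+1). *)
Definition exp_series (f : nat -> rat) (n : nat) : rat :=
  (\sum_(k < n.+1) (k`!%:R)^-1 *: (\poly_(i < n.+1) f i) ^+ k)`_n.

Definition log_zeta (n : nat) : rat :=
  if n is 0 then 0 else (num_points n)%:R / n%:R.

Definition zeta : nat -> rat := exp_series log_zeta.

(* P(t) = (1 - t)(1 - q t) zeta(t) as formal power series, q = #|F|. *)
Definition zeta_numerator (P : {poly int}) : Prop :=
  forall n, (P`_n)%:~R
    = ((1 - 'X) * (1 - #|F|%:R *: 'X) * \poly_(i < n.+1) zeta i)`_n.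

(* For a non-singular curve, h is the number of divisor classes of degree zero
   of the function field, defined here as the value at 1 of the numerator of the
   zeta function. *)
Definition class_number (h : nat) : Prop :=
  exists2 P : {poly int}, zeta_numerator P & P.[1] = h%:Z.

Lemma class_number_uniq h1 h2 :
  class_number h1 -> class_number h2 -> h1 = h2.
Proof.
move=> [P1 zP1 e1] [P2 zP2 e2].
have eP: P1 = P2.
  apply/polyP=> n; apply: (@intr_inj rat).
  by rewrite zP1 zP2.
by move: e1; rewrite eP e2 => -[].
Qed.

End Curve.

(* Main.v *)
Require Import Defs.
From mathcomp Require Import all_boot all_order all_algebra all_fingroup.
From mathcomp Require Import all_solvable all_field all_character.
From mathcomp Require Import ring zify.

(** The curve a Y^m = b X^m + c Z^m, m = 2 l, is supersingular: since the order of
    p modulo l is even, u is congruent to -1 modulo m, and the Gauss sums that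
    count its points are powers of - u up to roots of unity.

    Counting over a field E with u^(2k) elements needs only the sums
    S(a) = sum over x of psi (a x^m), psi being an additive character of E that
    is invariant under x |-> x^u. For exponent u + 1 in place of m, the map
    x |-> x^(u+1) is quadratic over the field of u elements; squaring the sum
    gives S(a)^2 = u^(2k), except on one class of a modulo (u+1)-st powers where
    it is u^(2k+2) (power_sum_sqr), and the congruence of S(a) to 1 modulo
    u + 1 fixes the sign (power_sum_norm). This works for all k alike, without
    lifting Gauss sums from smaller fields. Averaging gives, for every m
    dividing u + 1, S(a) = (-u)^k (1 - m [a in one class of m-th power residues])
    (power_sum_dvd_norm), and by orthogonality the number of projective points
    is
      #|E| + 1 + (-u)^k (-2 + m e - m^2 e'),
    where e counts the coincidences among the classes of a, b, c modulo m-th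
    powers, and e' is 1 if all three coincide and 0 otherwise.

    In the extension of degree n of F, a/b, a/c and b/c become m-th powers when
    m divides n (j - i), n j and n i, that is, when n is a multiple of the order
    d_1, d_2, d_3 of the index modulo m (num_points_diagonal). With
    w = (-u)^s and d the least common multiple of d_1 and d_2, the logarithmic
    derivative of the zeta function is therefore that of
      P(t) = (1 - w t)^2 (1 - (w t)^d)^(m^2/d) / prod_i (1 - (w t)^d_i)^(m/d_i),
    up to the factors 1 - t and 1 - q t (zeta_numerator_diagonal). The orders
    divide 2 l, so P is a product of powers of the four cyclotomic factors of
    1 - (w t)^(2 l), and the seven closed forms for P(1) correspond to the
    possible triples of orders: (1,1,1), (l,l,l), (1,l,l), (1,2,2),
    (1,2l,2l), (l,2l,2l) and (2,l,2l), up to permutation. *)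

Set Implicit Arguments.
Unset Strict Implicit.
Unset Printing Implicit Defensive.

Import Order.TTheory GRing.Theory Num.Theory FinRing.Theory.
Local Open Scope ring_scope.

(** * Power series through their logarithmic derivatives *)

Lemma dvdXnP (K : fieldType) (N : nat) (p : {poly K}) :
  reflect (forall i, (i < N)%N -> p`_i = 0) ('X^N %| p).
Proof.
apply: (iffP idP) => [/dvdpP [q ->] i iN|p0]; first by rewrite coefMXn iN.
rewrite -(poly_take_drop N p) dvdp_addl ?dvdp_mulIr //.
suff ->: take_poly N p = 0 by rewrite dvdp0.
by apply/polyP=> i; rewrite coef_take_poly coef0; case: ifP => // /p0.
Qed.

Lemma dvdXn_deriv (K : fieldType) N (p : {poly K}) : 'X^(N.+1) %| p -> 'X^N %| p^`().
Proof.
move/dvdXnP=> p0; apply/dvdXnP=> i iN.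
by rewrite coef_deriv p0 // mul0rn.
Qed.

Section LogarithmicDerivative.

Variable K : numFieldType.

(** M is the logarithmic derivative of p modulo X^N, in the division-free form
    p' = M p, so that no inverse power series is ever needed. *)
Definition logder N (M p : {poly K}) := 'X^N %| p^`() - M * p.

Lemma logder_congr_log N M M' p :
  'X^N %| M - M' -> logder N M p -> logder N M' p.
Proof.
move=> dM Lp; rewrite /logder.
have ->: p^`() - M' * p = (M - M') * p + (p^`() - M * p) by ring.
by rewrite dvdp_add ?dvdp_mulr.
Qed.

Lemma logder_congr N M p r :
  'X^(N.+1) %| p - r -> logder N M p -> logder N M r.
Proof.
move=> dpr; rewrite /logder.
have ->: r^`() - M * r = (p^`() - M * p) - ((p - r)^`() - M * (p - r)).
  by rewrite derivB; ring.
move=> Lp; apply: dvdp_sub => //; apply: dvdp_sub; first exact: dvdXn_deriv.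
by rewrite dvdp_mull // (dvdp_trans _ dpr) // dvdp_exp2l.
Qed.

Lemma logder_leq N N' M p : (N' <= N)%N -> logder N M p -> logder N' M p.
Proof. by move=> le; apply: dvdp_trans; rewrite dvdp_exp2l. Qed.

(** In characteristic 0 the equation p' = M p determines p from its constant
    coefficient, one coefficient at a time. *)
Lemma logder_uniq N M (p r : {poly K}) :
  p`_0 = r`_0 -> logder N M p -> logder N M r -> 'X^(N.+1) %| p - r.
Proof.
move=> e0 Lp Lr; pose e := p - r.
have Le : 'X^N %| e^`() - M * e.
  have ->: e^`() - M * e = (p^`() - M * p) - (r^`() - M * r).
    by rewrite derivB /e; ring.
  exact: dvdp_sub.
have e_le k : (k <= N)%N -> 'X^(k.+1) %| e.
  elim: k => [_|k IHk kN].
    by apply/dvdXnP=> -[|//] _; rewrite coefB e0 subrr.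
  have {}IHk := IHk (ltnW kN).
  have dke : 'X^(k.+1) %| e^`().
    rewrite -(subrK (M * e) e^`()) dvdp_add ?dvdp_mull //.
    by rewrite (dvdp_trans _ Le) // dvdp_exp2l.
  apply/dvdXnP=> -[|i] ik; first exact: (dvdXnP _ _ IHk).
  have /eqP := dvdXnP _ _ dke i ik.
  by rewrite coef_deriv -mulr_natr mulf_eq0 pnatr_eq0 orbF => /eqP.
exact: e_le.
Qed.

Lemma logder1 N : logder N 0 1.
Proof. by rewrite /logder derivC mul0r subr0 dvdp0. Qed.

Lemma logderM N M M' p r :
  logder N M p -> logder N M' r -> logder N (M + M') (p * r).
Proof.
move=> Lp Lr; rewrite /logder derivM.
have ->: p^`() * r + p * r^`() - (M + M') * (p * r)
  = r * (p^`() - M * p) + p * (r^`() - M' * r) by ring.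
by rewrite dvdp_add // dvdp_mull.
Qed.

Lemma logderX N M p n : logder N M p -> logder N (M *+ n) (p ^+ n).
Proof.
move=> Lp; elim: n => [|n IHn]; first exact: logder1.
by rewrite exprS mulrS; apply: logderM.
Qed.

(** Quotients are handled by cancellation: a series with nonzero constant
    coefficient is prime to X^N. *)
Lemma logder_cancel N M M' (p r : {poly K}) :
  p`_0 != 0 -> logder N M p -> logder N (M' + M) (r * p) -> logder N M' r.
Proof.
move=> p0 Lp; rewrite /logder derivM.
have ->: r^`() * p + r * p^`() - (M' + M) * (r * p)
  = p * (r^`() - M' * r) + r * (p^`() - M * p) by ring.
have cXp : coprimep 'X^N p.
  by rewrite coprimep_expl // coprimep_sym coprimepX /root horner_coef0.
by rewrite dvdp_addl; [rewrite Gauss_dvdpr | rewrite dvdp_mull].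
Qed.

Definition exp_trunc N (f : {poly K}) : {poly K} :=
  \sum_(k < N.+1) (k`!%:R)^-1 *: f ^+ k.

Lemma exp_trunc0 N (f : {poly K}) : f`_0 = 0 -> (exp_trunc N f)`_0 = 1.
Proof.
move=> f0; rewrite coef_sum big_ord_recl big1 /= ?addr0 => [|i _].
  by rewrite fact0 invr1 scale1r coefC.
by rewrite coefZ exprS coef0M f0 mul0r mulr0.
Qed.

(** The derivative of the truncated exponential series of f is f' times the
    same series without its last term, which X^N divides as f(0) = 0. *)
Lemma logder_exp_trunc N (f : {poly K}) : f`_0 = 0 -> logder N f^`() (exp_trunc N f).
Proof.
move=> f0; rewrite /logder.
have ->: (exp_trunc N f)^`() = f^`() * \sum_(k < N) (k`!%:R)^-1 *: f ^+ k.
  rewrite /exp_trunc raddf_sum /= big_ord_recl derivZ derivC scaler0 add0r mulr_sumr.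
  apply: eq_bigr => k _; rewrite derivZ deriv_exp /= /bump /= add1n /=.
  rewrite -scaler_nat scalerA factS natrM invfM mulrC mulrA divff ?pnatr_eq0 //.
  by rewrite mul1r -scalerAr mulrC.
rewrite /exp_trunc big_ord_recr /= mulrDr opprD addrA subrr sub0r.
rewrite dvdpNr -scalerAr dvdpZr ?invr_eq0 ?pnatr_eq0 -?lt0n ?fact_gt0 //.
rewrite dvdp_mull // dvdp_exp2r //.
by rewrite -['X]expr1; apply/dvdXnP=> -[|//] _.
Qed.

End LogarithmicDerivative.

(** The n-th coefficient of an exponential series is computed at precision n,
    so different coefficients come from different truncations; they agree
    because the logarithmic derivative determines them all. *)
Lemma logder_exp_series N (f : nat -> rat) : f 0%N = 0 ->
  logder N (\poly_(k < N) ((k.+1)%:R * f k.+1))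
           (\poly_(i < N.+1) exp_series f i).
Proof.
move=> f0; pose t n := \poly_(i < n.+1) f i.
have t0 n : (t n)`_0 = 0 by rewrite coef_poly f0.
have dt n k : (t n)^`()`_k = if (k < n)%N then k.+1%:R * f k.+1 else 0.
  rewrite coef_deriv coef_poly ltnS; case: ifP => _; last by rewrite mul0rn.
  by rewrite mulr_natl.
apply: (@logder_congr_log _ _ (t N)^`()).
  by apply/dvdXnP=> k kN; rewrite coefB dt coef_poly kN subrr.
apply: (logder_congr _ (logder_exp_trunc N (t0 N))).
apply/dvdXnP=> i iN; rewrite coefB coef_poly iN.
suff: 'X^(i.+1) %| exp_trunc N (t N) - exp_trunc i (t i).
  by move/dvdXnP/(_ i (ltnSn i)); rewrite coefB.
apply: (@logder_uniq _ _ (t i)^`()); rewrite ?exp_trunc0 //; last first.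
  exact: logder_exp_trunc.
apply: (@logder_congr_log _ _ (t N)^`()).
  apply/dvdXnP=> k ki; rewrite coefB !dt ki (leq_trans ki) ?subrr //.
apply: (@logder_leq _ N) => //; exact: logder_exp_trunc.
Qed.

Definition one_sub_pow (R : nzRingType) (w : R) (d : nat) : {poly R} :=
  1 - w ^+ d *: 'X^d.

Definition log_one_sub_pow N (w : rat) d : {poly rat} :=
  \poly_(k < N) (- ((d %| k.+1)%N * d)%:R * w ^+ k.+1).

(** t (log (1 - (w t)^d))' = - d (w t)^d / (1 - (w t)^d), whose expansion is
    supported on the multiples of d. *)
Lemma logder_one_sub_pow N w d : (0 < d)%N ->
  logder N (log_one_sub_pow N w d) (one_sub_pow w d).
Proof.
move=> d0; apply/dvdXnP=> k kN; rewrite /one_sub_pow.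
rewrite derivB derivC sub0r derivZ derivXn mulrBr mulr1 -scalerAr.
rewrite coefB coefN coefZ coefMn coefXn coefB coefZ coefMXn !coef_poly kN.
have [kd|dk] := ltnP k d.
  rewrite mulr0 subr0; case: eqP => [kE|kE].
    have kE' : k.+1 = d by rewrite kE prednK.
    by rewrite kE' dvdnn mul1n mulNr opprK mulrC addNr.
  rewrite mul0rn mulr0 oppr0 sub0r gtnNdvd ?mul0n ?oppr0 ?mul0r ?oppr0 //.
  rewrite ltn_neqAle kd andbT; apply/eqP=> kE'; apply: kE.
  by rewrite -kE'.
rewrite (leq_ltn_trans (leq_subr d k) kN).
rewrite gtn_eqF; last by rewrite (leq_trans _ dk) // ltn_predL.
rewrite mul0rn mulr0 oppr0 -subSn // dvdn_subl ?dvdnn //; last exact: leqW.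
rewrite mulrCA -exprD subnKC ?subrr ?oppr0 ?addr0 //; exact: leqW.
Qed.

Lemma one_sub_pow0 (R : nzRingType) (w : R) d :
  (0 < d)%N -> (one_sub_pow w d)`_0 = 1.
Proof. by case: d => // d _; rewrite coefB coefZ coefXn mulr0 subr0 coefC. Qed.

Lemma map_one_sub_pow (w : int) d :
  map_poly intr (one_sub_pow w d) = one_sub_pow (w%:~R : rat) d.
Proof.
rewrite /one_sub_pow rmorphB rmorph1 /= map_polyZ map_polyXn /=.
by rewrite rmorphXn.
Qed.

(** P is the numerator of the zeta function as soon as
    t P' / P = sum over n of (N_n - 1 - q^n) t^n, N_n being the number of points
    over the extension of degree n: the factors 1 - t and 1 - q t account for
    1 and q^n, and the zeta function for N_n. *)
Lemma zeta_numeratorP (F : finFieldType) (a b c : F) m (P : {poly int}) :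
    P`_0 = 1 ->
    (forall n, logder n
       (\poly_(k < n) ((num_points a b c m k.+1)%:R - 1 - (#|F|%:R) ^+ k.+1))
       (map_poly intr P : {poly rat})) ->
  zeta_numerator a b c m P.
Proof.
move=> P0 LP n.
pose G : {poly rat} :=
  (1 - 'X) * (1 - #|F|%:R *: 'X) * \poly_(i < n.+1) zeta a b c m i.
rewrite -/G.
suff: 'X^(n.+1) %| map_poly intr P - G.
  move/dvdXnP/(_ n (ltnSn n)); rewrite coefB coef_map /= => /eqP.
  by rewrite subr_eq0 => /eqP.
have -> : G = one_sub_pow 1 1 * one_sub_pow #|F|%:R 1
    * \poly_(i < n.+1) zeta a b c m i.
  by rewrite /one_sub_pow !expr1 scale1r.
have z0 : zeta a b c m 0 = 1.
  rewrite /zeta /exp_series big_ord1 fact0 invr1 scale1r expr0.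
  by rewrite coefC.
apply: logder_uniq (LP n) _.
  by rewrite coef_map P0 !coef0M !one_sub_pow0 // coef_poly z0 !mulr1.
apply: logder_congr_log; last first.
  apply: logderM; first apply: logderM.
  - exact: logder_one_sub_pow.
  - exact: logder_one_sub_pow.
  - exact: logder_exp_series.
apply/dvdXnP=> k kn; rewrite !(coefB, coefD) !coef_poly kn.
rewrite dvd1n /= mul1n expr1n mulrCA divff ?mulr1 ?pnatr_eq0 //.
by ring.
Qed.

(** The power sums of the reciprocal roots of
    (1 - w t)^2 (1 - (w t)^d)^e / prod_i (1 - (w t)^d_i)^e_i. *)
Lemma logder_ratio_of_products N (w : rat) d1 d2 d3 d e1 e2 e3 e (p : {poly rat}) :
    (0 < d1)%N -> (0 < d2)%N -> (0 < d3)%N -> (0 < d)%N ->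
    p * (one_sub_pow w d1 ^+ e1 * one_sub_pow w d2 ^+ e2
         * one_sub_pow w d3 ^+ e3)
      = one_sub_pow w 1 ^+ 2 * one_sub_pow w d ^+ e ->
  p`_0 = 1 /\
  logder N (\poly_(k < N) (w ^+ k.+1 *
     ((e1 * d1 * (d1 %| k.+1) + e2 * d2 * (d2 %| k.+1)
       + e3 * d3 * (d3 %| k.+1))%:R - 2 - (e * d * (d %| k.+1))%:R))) p.
Proof.
move=> d1_0 d2_0 d3_0 d_0 pE.
have c0X d' e' : (0 < d')%N -> (one_sub_pow w d' ^+ e')`_0 = 1.
  by move=> d'0; rewrite -horner_coef0 horner_exp horner_coef0 one_sub_pow0 // expr1n.
have p0 : p`_0 = 1.
  have := congr1 (fun r : {poly rat} => r`_0) pE.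
  by rewrite /= !coef0M !c0X ?one_sub_pow0 // !mulr1.
split=> //.
have LX d' e' : (0 < d')%N -> logder N (log_one_sub_pow N w d' *+ e')
     (one_sub_pow w d' ^+ e').
  by move=> d'0; apply/logderX/logder_one_sub_pow.
apply: (logder_cancel _ (logderM (logderM (LX _ e1 d1_0) (LX _ e2 d2_0))
   (LX _ e3 d3_0))).
  by rewrite !coef0M !c0X // !mulr1 oner_eq0.
rewrite pE; apply: logder_congr_log (logderM (LX 1%N 2%N isT) (LX _ e d_0)).
apply/dvdXnP=> k kn; rewrite !coefB !coefD !coefMn !coef_poly kn.
rewrite dvd1n mul1n -[_ *+ 2]mulr_natr -[_ *+ e1]mulr_natr.
rewrite -[_ *+ e2]mulr_natr -[_ *+ e3]mulr_natr -[_ *+ e]mulr_natr !natrD !natrM.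
(* the powers and casts become atoms for ring *)
move: (w ^+ k.+1) (d1 %| _)%N%:R (d2 %| _)%N%:R (d3 %| _)%N%:R (d %| _)%N%:R.
move: e1%:R e2%:R e3%:R e%:R d1%:R d2%:R d3%:R d%:R.
by move=> *; ring.
Qed.

(** * Power residues in finite fields *)

Section PowerResidues.

Variable E : finFieldType.

Lemma expf_card1 (x : E) : x != 0 -> x ^+ #|E|.-1 = 1.
Proof.
move=> x0; apply: (mulfI x0); rewrite mulr1 -exprS prednK ?expf_card //.
by rewrite ltnW ?finNzRing_gt1.
Qed.

Lemma card1_gt0 : (0 < #|E|.-1)%N.
Proof. by rewrite -ltnS prednK ?finNzRing_gt1 // ltnW ?finNzRing_gt1. Qed.

Lemma prim_root_exists : {g : E | #|E|.-1.-primitive_root g}.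
Proof.
apply/sigW; suff /hasP[g _ g_prim] : has #|E|.-1.-primitive_root
    [seq x : E <- enum {: E} | x != 0] by exists g.
apply: has_prim_root; first exact: card1_gt0.
- apply/allP=> x; rewrite mem_filter => /andP[x0 _].
  by apply/unity_rootP/expf_card1.
- exact/filter_uniq/enum_uniq.
rewrite -(cardC1 (0 : E)) cardE; apply: uniq_leq_size (enum_uniq _) _ => x.
by rewrite mem_enum => x0; rewrite mem_filter mem_enum andbT.
Qed.

(** As the multiplicative group is cyclic, the r-th powers are the elements
    killed by (#|E| - 1) / r, and each of them is a value of x^r taken r times. *)
Lemma card_roots r (c : E) : (r %| #|E|.-1)%N -> c != 0 ->
  #|[set z : E | z ^+ r == c]| = (r * (c ^+ (#|E|.-1 %/ r) == 1%R))%N.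
Proof.
move=> rQ c0; have [g g_prim] := prim_root_exists.
have r0 : (0 < r)%N by apply: dvdn_gt0 rQ; apply: card1_gt0.
case: eqP => [c1|c1]; rewrite ?muln1 ?muln0; last first.
  apply/eqP; rewrite cards_eq0; apply/eqP/setP=> z; rewrite !inE.
  apply/eqP=> zc; case: c1; rewrite -zc -exprM mulnC divnK //.
  apply: expf_card1; apply: contraNneq c0 => z0.
  by rewrite -zc z0 expr0n gtn_eqF.
have [[t _] /= ct] := prim_rootP g_prim (expf_card1 c0).
have /dvdnP[k tk] : (r %| t)%N.
  move: c1; rewrite ct -exprM => /eqP; rewrite -(prim_order_dvd g_prim).
  rewrite -{1}(divnK rQ) [(t * _)%N]mulnC dvdn_pmul2l //.
  by rewrite divn_gt0 // dvdn_leq // card1_gt0.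
have h_prim := dvdn_prim_root g_prim rQ; set h := g ^+ _ in h_prim.
have z0 : g ^+ k != 0.
  apply: contraNneq c0 => g0.
  by rewrite ct tk exprM g0 expr0n gtn_eqF.
rewrite -[RHS]card_ord -(card_image (f := fun i : 'I_r => h ^+ i * g ^+ k)).
  apply: eq_card => z; rewrite inE ct tk exprM.
  apply/eqP/imageP => [zr|[i _ ->]]; last first.
    by rewrite exprMn (exprAC h) (prim_expr_order h_prim) expr1n mul1r.
  have zr1 : (z / g ^+ k) ^+ r = 1.
    by rewrite expr_div_n zr divff // expf_neq0.
  have [i zi] := prim_rootP h_prim zr1.
  by exists i => //; rewrite -zi divfK.
move=> i j /(mulIf z0) /eqP; rewrite (eq_prim_root_expr h_prim).
by rewrite !modn_small // => /eqP /val_inj.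
Qed.

Lemma sum_expr (R : zmodType) r (f : E -> R) : (r %| #|E|.-1)%N ->
  \sum_(x : E | x != 0) f (x ^+ r)
    = \sum_(y : E | (y != 0) && (y ^+ (#|E|.-1 %/ r) == 1)) f y *+ r.
Proof.
move=> rQ; have r0 : (0 < r)%N by apply: dvdn_gt0 rQ; apply: card1_gt0.
rewrite (partition_big (fun x => x ^+ r) (predC1 (0 : E))) /=; last first.
  by move=> x x0; rewrite expf_neq0.
rewrite (bigID (fun y : E => y ^+ (#|E|.-1 %/ r) == 1)) /=.
rewrite [X in _ + X]big1 ?addr0 => [|y /andP[y0 yr]].
  apply: eq_bigr => y /andP[y0 yr].
  rewrite (eq_bigr (fun=> f y)) => [|x /andP[_ /eqP->]] //.
  rewrite sumr_const -[in RHS](muln1 r); congr (_ *+ _).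
  transitivity #|[set z : E | z ^+ r == y]|; last by rewrite card_roots // yr.
  apply: eq_card => x; rewrite !inE.
  rewrite [LHS]unfold_in; case: (eqVneq x 0) => // ->.
  by rewrite /= expr0n gtn_eqF //= eq_sym (negbTE y0).
rewrite big1 // => x /andP[x0 /eqP xy]; case/negP: yr.
by rewrite -xy -exprM mulnC divnK // expf_card1.
Qed.

End PowerResidues.

(** * Additive characters of finite fields *)

Definition additive_character (E : finFieldType) (psi : E -> algC) : Prop :=
  [/\ psi 0 = 1, {morph psi : x y / x + y >-> x * y}
    & exists z, psi z != 1].

(** Any nonprincipal irreducible character of the additive group will do. *)
Lemma additive_character_exists (E : finFieldType) :
  exists psi : E -> algC, additive_character psi.
Proof.
have abE : abelian [set: E] by exact: zmod_abelian.
have lin i := char_abelianP _ abE i.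
have i1 : (1 < Nirr [set: E])%N.
  rewrite NirrE; move: abE; rewrite card_classes_abelian => /eqP->.
  by rewrite cardsT finNzRing_gt1.
pose i : Iirr [set: E] := inord 1.
have ni : i != 0.
  by apply/eqP=> /(congr1 val); rewrite /= inordK //; exact: i1.
exists 'chi_i; split; first exact: (lin_char1 (lin i)).
  move=> x y; exact: (lin_charM (lin i) (in_setT x) (in_setT y)).
apply/existsP; apply: contraNT ni; rewrite negb_exists => /forallP chi1.
apply/eqP/irr_inj; rewrite irr0; apply/cfunP=> x.
by rewrite cfun1E in_setT; apply/eqP; have := chi1 x; rewrite negbK.
Qed.

Section AdditiveCharacter.

Variables (E : finFieldType) (psi : E -> algC).
Hypothesis psi_char : additive_character psi.

Let psi0 : psi 0 = 1. Proof. by case: psi_char. Qed.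
Let psiD x y : psi (x + y) = psi x * psi y. Proof. by case: psi_char. Qed.

Lemma addchar_pchar p x : p \in [pchar E] -> psi x ^+ p = 1.
Proof.
move=> pE; rewrite -psi0 -(mulrn_pchar pE x).
elim: (p) => [|n IHn]; first by rewrite mulr0n psi0.
by rewrite exprS mulrS psiD IHn.
Qed.

Lemma addchar_Aint x : psi x \in Aint.
Proof.
have [p p_pr pE] := finPcharP E.
apply: (@Aint_unity_root p); first exact: prime_gt0.
by apply/unity_rootP; apply: addchar_pchar.
Qed.

(** Orthogonality: the sum is invariant under multiplication by a value of psi
    other than 1. *)
Lemma addchar_sum (a : E) :
  \sum_x psi (a * x) = if a == 0 then #|E|%:R else 0.
Proof.
case: eqVneq => [->|a0].
  under eq_bigr => x _ do rewrite mul0r psi0.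
  by rewrite sumr_const.
have [_ _ [z z1]] := psi_char.
set S := \sum_x _; suff : psi z * S = S.
  move/eqP; rewrite -subr_eq0 -[X in _ - X]mul1r -mulrBl mulf_eq0 subr_eq0.
  by rewrite (negbTE z1) => /eqP.
rewrite mulr_sumr /S [RHS](reindex_inj (addrI (z / a))) /=.
by apply: eq_bigr => x _; rewrite mulrDr psiD mulrCA divff // mulr1.
Qed.

(** psi x is its own inverse and a p-th root of unity with p odd. *)
Lemma addchar_antifixed p x :
  p \in [pchar E] -> odd p -> psi (- x) = psi x -> psi x = 1.
Proof.
move=> pE p_odd psiN; have := addchar_pchar x pE.
have xx : psi x ^+ 2 = 1 by rewrite expr2 -{2}psiN -psiD subrr.
by rewrite -(odd_double_half p) p_odd -mul2n exprD exprM xx expr1n mulr1.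
Qed.

End AdditiveCharacter.

(** Compose any character with the trace x + x^u + x^(u^2) + .. down to the
    field of u elements: the trace is invariant under x |-> x^u, and it does not
    vanish identically, being a polynomial of degree less than #|E|. *)
Lemma invariant_character_exists (E : finFieldType) (u n : nat) :
    [pchar E].-nat u -> (1 < u)%N -> #|E| = (u ^ n)%N ->
  exists2 psi : E -> algC, additive_character psi
    & forall x, psi (x ^+ u) = psi x.
Proof.
move=> u_pchar u_gt1 cardEu.
have [psi psi_char] := additive_character_exists E.
pose T (x : E) := \sum_(i < n) x ^+ (u ^ i).
have uXi i : [pchar E].-nat (u ^ i)%N by rewrite pnatX u_pchar.
have TD : {morph T : x y / x + y}.
  move=> x y; rewrite /T -big_split /=; apply: eq_bigr => i _.
  exact: exprDn_pchar.
have n_gt0 : (0 < n)%N.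
  by case: n cardEu {T TD} => // e; have := finNzRing_gt1 E; rewrite e expn0.
have Tu x : T (x ^+ u) = T x.
  rewrite /T; case: (n) n_gt0 cardEu => // k _ cardE'.
  rewrite big_ord_recr big_ord_recl /= addrC -exprM -expnS -cardE' expf_card.
  congr (_ + _); apply: eq_bigr => i _.
  by rewrite -exprM -expnS.
have T_neq0 : exists c, T c != 0.
  apply/existsP; apply: contraT; rewrite negb_exists => /forallP T0.
  pose q : {poly E} := \sum_(i < n) 'X^(u ^ i).
  have size_q : (size q <= (u ^ n.-1).+1)%N.
    apply: (leq_trans (size_sum _ _ _)); apply/bigmax_leqP => i _.
    rewrite size_polyXn ltnS (leq_pexp2l (ltnW u_gt1)) //.
    by rewrite -ltnS (prednK n_gt0).
  have q0 : q != 0.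
    apply/eqP=> /(congr1 (fun r : {poly E} => r`_(u ^ 0))) /eqP.
    rewrite coef0 coef_sum -(prednK n_gt0) big_ord_recl /= coefXn eqxx.
    rewrite big1 ?addr0 ?oner_eq0 // => i _.
    by rewrite coefXn eqn_exp2l.
  have rts : all (root q) (enum {: E}).
    apply/allP=> x _; rewrite /root horner_sum -[X in _ == X](eqP (negPn (T0 x))).
    by apply/eqP/eq_bigr => i _; rewrite hornerXn.
  have := max_poly_roots q0 rts (enum_uniq _).
  rewrite -cardE cardEu => /leq_trans/(_ size_q).
  by rewrite ltnS leq_exp2l // -{1}(prednK n_gt0) ltnn.
have [x0 Tx0] := T_neq0; have [psi0 psiD [z z1]] := psi_char.
exists (fun x => psi (z / T x0 * T x)); last by move=> x; rewrite Tu.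
split; last by exists x0; rewrite divfK.
  rewrite (_ : T 0 = 0) ?mulr0 //.
  by apply: (addIr (T 0)); rewrite -TD !add0r.
by move=> x y; rewrite TD mulrDr psiD.
Qed.

(** * Pure power sums *)

Definition power_sum (E : finFieldType) (psi : E -> algC) (r : nat) (a : E) :=
  \sum_x psi (a * x ^+ r).

(** The map x |-> x^(u+1) is quadratic over the field of u elements:
    (y+h)^(u+1) - y^(u+1) - h^(u+1) is additive in y. This is why the sums of
    psi (a x^(u+1)) can be evaluated like quadratic Gauss sums, by squaring. *)
Section PurePowerSums.

Variables (E : finFieldType) (psi : E -> algC) (u k : nat).
Hypothesis psi_char : additive_character psi.
Hypothesis psi_u : forall x, psi (x ^+ u) = psi x.
Hypotheses (u_pchar : [pchar E].-nat u) (u_odd : odd u) (u_gt1 : (1 < u)%N).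
Hypotheses (k_gt0 : (0 < k)%N) (cardEu : #|E| = (u ^ (2 * k))%N).

Local Notation S := (power_sum psi).

Let psi0 : psi 0 = 1. Proof. by case: psi_char. Qed.
Let psiD x y : psi (x + y) = psi x * psi y. Proof. by case: psi_char. Qed.

Let t := (\sum_(i < k) (u ^ 2) ^ i)%N.

Let predQ : #|E|.-1 = ((u ^ 2).-1 * t)%N.
Proof. by rewrite cardEu expnM predn_exp. Qed.

Let pred_u2 : (u ^ 2).-1 = (u.-1 * u.+1)%N.
Proof. by rewrite predn_exp !big_ord_recl big_ord0 addn0 expn0 expn1 add1n. Qed.

Let odd_t : odd t = odd k.
Proof.
rewrite /t (big_morph odd oddD (erefl _)) (eq_bigr (fun=> true)) => [|i _].
  by rewrite big_const card_ord; elim: (k) => //= n ->.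
by rewrite !oddX u_odd !orbT.
Qed.

Let u1Q : (u.+1 %| #|E|.-1)%N.
Proof. by rewrite predQ pred_u2 -mulnA dvdn_mull // dvdn_mulr. Qed.

Let divQu1 : (#|E|.-1 %/ u.+1 = u.-1 * t)%N.
Proof. by rewrite predQ pred_u2 -mulnA mulnCA mulKn. Qed.

Let u_gt0 : (0 < u)%N. Proof. exact: ltnW. Qed.

(** -1 is a (u+1)-st power, hence the power sums take the same value at a and
    -a. *)
Lemma sqrtN1_norm : exists2 nu : E, nu != 0 & nu ^+ u.+1 = -1.
Proof.
have N1_neq0 : (-1 : E) != 0 by rewrite oppr_eq0 oner_eq0.
have := card_roots u1Q N1_neq0; rewrite divQu1 exprM -signr_odd.
rewrite -subn1 oddB // u_odd expr1n eqxx muln1 => card_nu.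
have /card_gt0P[nu] : (0 < #|[set z : E | (z ^+ u.+1 == -1)%R]|)%N by rewrite card_nu.
rewrite inE => /eqP nuE; exists nu => //.
by apply: contra_eqN nuE => /eqP->; rewrite expr0n eq_sym oppr_eq0 oner_eq0.
Qed.

(* the inverse of the bijection x |-> x^u *)
Let rt (x : E) := x ^+ (u ^ (2 * k).-1).

Let rtK x : rt x ^+ u = x.
Proof.
rewrite /rt -exprM -expnSr prednK ?muln_gt0 // -cardEu.
exact: expf_card.
Qed.

Let expuD (x y : E) : (x + y) ^+ u = x ^+ u + y ^+ u.
Proof. exact: exprDn_pchar. Qed.

(** Write the square as the sum over x and y of
    psi (a x^(u+1) - a y^(u+1)), put x = y + h, and sum over y: the exponent is
    additive in y, so that orthogonality applies once psi (a h y^u) has been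
    rewritten as psi (rt (a h) y). *)
Lemma power_sum_sqr_shift (a : E) :
  S u.+1 a ^+ 2 = \sum_h psi (a * h ^+ u.+1)
     * (if rt (a * h) + a * h ^+ u == 0 then #|E|%:R else 0).
Proof.
have [nu nu0 nuE] := sqrtN1_norm.
have SN : S u.+1 a = \sum_y psi (- (a * y ^+ u.+1)).
  rewrite /power_sum (reindex_inj (mulfI nu0)) /=; apply: eq_bigr => y _.
  by rewrite exprMn nuE mulN1r mulrN.
rewrite expr2 {1}SN /power_sum mulr_suml.
have shift y : psi (- (a * y ^+ u.+1)) * \sum_x psi (a * x ^+ u.+1)
   = \sum_h psi (a * h ^+ u.+1) * psi ((rt (a * h) + a * h ^+ u) * y).
  rewrite mulr_sumr (reindex_inj (addrI y)) /=; apply: eq_bigr => h _.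
  rewrite mulrDl psiD -[psi (rt _ * y)]psi_u exprMn rtK -!psiD.
  by congr psi; rewrite (exprSr (y + h)) expuD !exprSr; ring.
rewrite (eq_bigr _ (fun y _ => shift y)) exchange_big /=.
apply: eq_bigr => h _; rewrite -mulr_sumr; congr (_ * _).
exact: addchar_sum.
Qed.

Let rt_eq0 (a h : E) : (rt (a * h) + a * h ^+ u == 0)
  = (a * h + a ^+ u * h ^+ (u ^ 2) == 0).
Proof.
transitivity ((rt (a * h) + a * h ^+ u) ^+ u == 0).
  by rewrite expf_eq0 u_gt0.
by rewrite expuD rtK exprMn -exprM.
Qed.

(** For h in the radical, w = a h^(u+1) satisfies psi (- w) = psi w, so the
    corresponding term is #|E|. A nonzero h is in the radical when
    h^(u^2-1) = - 1 / a^(u-1), which has no solution or u^2 - 1 of them. *)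
Lemma power_sum_sqr (a : E) : a != 0 ->
  S u.+1 a ^+ 2 = (#|E| * (1 + (u ^ 2).-1
       * (a ^+ (#|E|.-1 %/ u.+1) == (-1) ^+ k)))%:R.
Proof.
move=> a0; rewrite power_sum_sqr_shift.
have [p_gt1 p_dvd] : (1 < pdiv u)%N /\ (pdiv u %| u)%N.
  by rewrite pdiv_dvd prime_gt1 ?pdiv_prime.
have pE : pdiv u \in [pchar E].
  by apply: (pnatPpi u_pchar); rewrite mem_primes pdiv_prime ?u_gt0 ?pdiv_dvd.
have p_odd : odd (pdiv u) by apply: dvdn_odd u_odd.
rewrite (bigID (fun h => rt (a * h) + a * h ^+ u == 0)) /=.
rewrite [X in _ + X]big1 ?addr0 => [|h /negbTE->]; last by rewrite mulr0.
rewrite (eq_bigr (fun=> #|E|%:R)) => [|h h0]; last first.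
  rewrite h0 (addchar_antifixed psi_char pE p_odd) ?mul1r //.
  rewrite exprS mulrCA -mulrN.
  move: h0; rewrite addr_eq0 => /eqP <-.
  by rewrite -[LHS]psi_u exprMn rtK; congr psi; ring.
rewrite sumr_const natrM -[LHS]mulr_natr; congr (_ * _%:R).
have u2Q : ((u ^ 2).-1 %| #|E|.-1)%N by rewrite predQ dvdn_mulr.
have au0 : a ^+ u.-1 != 0 by rewrite expf_neq0.
pose c := - (a ^+ u.-1)^-1.
have c0 : c != 0 by rewrite oppr_eq0 invr_eq0.
have u2_gt0 : (0 < (u ^ 2).-1)%N by rewrite pred_u2 muln_gt0 andbT -ltnS prednK.
have in0 : rt (a * 0) + a * 0 ^+ u == 0.
  by rewrite rt_eq0 mulr0 expr0n gtn_eqF ?expn_gt0 ?u_gt0 // mulr0 addr0.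
rewrite (cardD1 0) [X in nat_of_bool X]in0; congr (_ + _)%N.
transitivity #|[set h : E | h ^+ (u ^ 2).-1 == c]|.
  apply: eq_card => h.
  transitivity ((h != 0) && (rt (a * h) + a * h ^+ u == 0)); first by rewrite !inE.
  rewrite inE rt_eq0.
  have [->|h0] /= := eqVneq h 0.
    by rewrite expr0n gtn_eqF // eq_sym (negbTE c0).
  have -> : h ^+ (u ^ 2) = h ^+ (u ^ 2).-1 * h.
    by rewrite -exprSr prednK // expn_gt0 u_gt0.
  have -> : a ^+ u = a ^+ u.-1 * a by rewrite -exprSr prednK.
  have ->: a * h + a ^+ u.-1 * a * (h ^+ (u ^ 2).-1 * h)
    = (a * h * a ^+ u.-1) * (h ^+ (u ^ 2).-1 - c).
    by rewrite /c opprK mulrDr mulfK //; ring.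
  by rewrite !mulf_eq0 (negbTE a0) (negbTE h0) (negbTE au0) subr_eq0.
rewrite card_roots //; congr (_ * nat_of_bool _)%N.
rewrite divQu1 predQ mulKn // /c (exprNn (a ^+ u.-1)^-1) exprVn.
rewrite -signr_odd odd_t signr_odd.
rewrite -(inj_eq (mulIf (expf_neq0 t au0))) mulfVK ?expf_neq0 // mul1r.
by rewrite eq_sym -exprM.
Qed.

(** Every value of x^r at x != 0 is taken r times. *)
Lemma power_sum_eqAmod (r : nat) (a : E) : (r %| #|E|.-1)%N ->
  (S r a == 1 %[mod r])%A.
Proof.
move=> rQ; have r_gt0 : (0 < r)%N by apply: dvdn_gt0 rQ; apply: card1_gt0.
rewrite /power_sum (bigD1 0) //= expr0n gtn_eqF // mulr0 psi0.
rewrite -[X in (_ == X %[mod _])%A]addr0 eqAmodDl.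
rewrite (sum_expr (fun y => psi (a * y))) // sumrMnl -mulr_natr eqAmodMl0 //.
by apply: rpred_sum => y _; apply: addchar_Aint.
Qed.

(** The square leaves a sign undetermined; it is fixed by the congruence of the
    sum to 1 modulo u + 1 > 2 in the algebraic integers, - u being congruent to
    1 as well. *)
Lemma power_sum_norm (a : E) : a != 0 ->
  S u.+1 a = (- u%:R) ^+ k
    * (1 - u.+1%:R * (a ^+ (#|E|.-1 %/ u.+1) == (-1) ^+ k)%:R).
Proof.
move=> a0; have := power_sum_sqr a0; set d := _ == _ => sqS.
(* d = 1 on the exceptional class, where 1 - (u + 1) = - u *)
have {}sqS : S u.+1 a ^+ 2 = ((- u%:R) ^+ (k + d)) ^+ 2.
  rewrite sqS cardEu -exprM [((k + d) * 2)%N]mulnC exprM sqrrN -exprM -natrX.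
  rewrite [(2 * (k + d))%N]mulnDr expnD; congr (_ * _)%:R.
  case: (d); last by rewrite muln0.
  by rewrite muln1 add1n prednK // expn_gt0 u_gt0.
have RHS_E : (- u%:R) ^+ (k + d)
    = (- u%:R) ^+ k * (1 - u.+1%:R * d%:R) :> algC.
  rewrite exprD; congr (_ * _); case: (d); last by rewrite mulr0 subr0.
  by rewrite mulr1 -natr1 opprD addrC -addrA addNr addr0.
rewrite -RHS_E; apply/eqP.
move/eqP: sqS; rewrite eqf_sqr => /orP[//|/eqP SN].
have u_mod : (- u%:R == 1 %[mod u.+1])%A.
  by rewrite -(eqAmodDl _ u%:R) addrN natr1 eqAmod_sym eqAmod0_nat.
have pow_mod n : ((- u%:R) ^+ n == 1 %[mod u.+1])%A.
  elim: n => [|n IHn]; first exact: eqAmod_refl.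
  rewrite exprS -[X in (_ == X %[mod _])%A]mulr1.
  by apply: eqAmodM => //; rewrite ?rpred1 ?rpredN ?rpred_nat.
have := power_sum_eqAmod a u1Q; rewrite SN eqAmodN.
rewrite (eqAmod_transl _ (pow_mod _)) => mod_1N1.
have := eqAmod0_nat u.+1 2; rewrite gtnNdvd // => /negP[].
by rewrite -(eqAmodDr _ 1 1 (-1)) addNr in mod_1N1.
Qed.

End PurePowerSums.

(** * Counting points over a fixed field *)

Section DiagonalCount.

Variables (E : finFieldType) (u k m : nat).
Hypotheses (u_pchar : [pchar E].-nat u) (u_odd : odd u) (u_gt1 : (1 < u)%N).
Hypotheses (k_gt0 : (0 < k)%N) (cardEu : #|E| = (u ^ (2 * k))%N).
Hypothesis m_dvd : (m %| u.+1)%N.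

Local Notation r := (#|E|.-1 %/ m)%N.
Local Notation W := ((- u%:R) ^+ k).
(* the common value of a^r on the exceptional class of m-th power residues *)
Let eps : E := (-1) ^+ (k * (u.+1 %/ m)).

Let predQ : exists t, #|E|.-1 = (u.-1 * (u.+1 * t))%N.
Proof.
rewrite cardEu expnM predn_exp predn_exp !big_ord_recl big_ord0.
by rewrite addn0 expn0 expn1 add1n -mulnA; eexists.
Qed.

Let u1Q : (u.+1 %| #|E|.-1)%N.
Proof. by have [t ->] := predQ; rewrite dvdn_mull // dvdn_mulr. Qed.

Let mQ : (m %| #|E|.-1)%N. Proof. exact: dvdn_trans u1Q. Qed.
Let m_gt0 : (0 < m)%N. Proof. by case: (m) m_dvd. Qed.
Let rQ : (r %| #|E|.-1)%N. Proof. by rewrite -{2}(divnK mQ) dvdn_mulr. Qed.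

Let r_even : ~~ odd r.
Proof.
have [t ->] := predQ; rewrite -(divnK m_dvd) mulnAC mulnA mulnK // oddM.
by rewrite -subn1 oddB ?u_odd // ltnW.
Qed.

Section WithCharacter.

Variable psi : E -> algC.
Hypothesis psi_char : additive_character psi.
Hypothesis psi_u : forall x, psi (x ^+ u) = psi x.

Let psi0 : psi 0 = 1. Proof. by case: psi_char. Qed.
Let psiD x y : psi (x + y) = psi x * psi y. Proof. by case: psi_char. Qed.

(** With v = (u + 1) / m, substituting x^v for x in the sum of exponent m gives
    the one of exponent u + 1. Averaging the latter at a z^m over z != 0 undoes
    the substitution. *)
Lemma power_sum_dvd_norm (a : E) : a != 0 ->
  power_sum psi m a = W * (1 - m%:R * (a ^+ r == eps)%:R).
Proof.
move=> a0; set v := (u.+1 %/ m)%N; set R := (#|E|.-1 %/ u.+1)%N.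
have mv : (v * m = u.+1)%N by rewrite divnK.
have RQ : (R * u.+1 = #|E|.-1)%N by rewrite divnK.
have rE : r = (R * v)%N by rewrite -RQ -mv mulnA mulnK.
have Q1_neq0 : #|E|.-1%:R != 0 :> algC by rewrite pnatr_eq0 -lt0n card1_gt0.
have card_nz : #|predC1 (0 : E)| = #|E|.-1 by rewrite cardC1.
apply: (mulfI Q1_neq0).
transitivity (\sum_(z | z != 0) power_sum psi u.+1 (a * z ^+ m)).
  have S0 : \sum_(z | z != 0) psi (a * z ^+ m * 0 ^+ u.+1) = #|E|.-1%:R.
    rewrite (eq_bigr (fun=> 1)) ?sumr_const ?card_nz // => z _.
    by rewrite expr0n mulr0 psi0.
  rewrite /power_sum exchange_big [RHS](bigD1 0) //= S0 [X in _ * X](bigD1 0) //=.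
  rewrite expr0n gtn_eqF // mulr0 psi0 mulrDr mulr1; congr (_ + _).
  rewrite mulr_natl -card_nz -sumr_const; apply: eq_bigr => x x0.
  have xv0 : x ^+ v != 0 by rewrite expf_neq0.
  rewrite [LHS](reindex_inj (mulIf xv0)) /=; apply: eq_big => z.
    by rewrite mulf_eq0 (negbTE xv0) orbF.
  by move=> _; rewrite exprMn -exprM mv mulrA.
rewrite (eq_bigr (fun z => W - W * u.+1%:R * (z ^+ (m * R) == (-1) ^+ k / a ^+ R)%:R));
    last first.
  move=> z z0; rewrite (power_sum_norm (k := k) psi_char) ?mulf_neq0 ?expf_neq0 //.
  rewrite -/R mulrBr mulr1 mulrA exprMn -exprM; congr (_ - _ * _%:R).
  by rewrite mulrC (can2_eq (mulfK _) (divfK _)) // expf_neq0.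
rewrite sumrB sumr_const card_nz -mulr_sumr -natr_sum.
have mRQ : (m * R %| #|E|.-1)%N by rewrite -RQ -mv mulnCA dvdn_mull // mulnC.
have mR_gt0 : (0 < m * R)%N.
  by rewrite muln_gt0 m_gt0 divn_gt0 // dvdn_leq // card1_gt0.
set c : E := (-1) ^+ k / a ^+ R; have c0 : c != 0.
  by rewrite mulf_neq0 ?invr_eq0 ?expf_neq0 // oppr_eq0 oner_eq0.
have -> : (\sum_(z : E | z != 0%R) (z ^+ (m * R) == c)%R
    = m * R * (a ^+ r == eps)%R)%N.
  transitivity #|[set z : E | z ^+ (m * R) == c]|.
    rewrite -sum1_card big_mkcond [RHS]big_mkcond /=; apply: eq_bigr => z _.
    rewrite inE; case: eqVneq => [->|] /=; last by case: eqP.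
    by rewrite expr0n gtn_eqF // eq_sym (negbTE c0).
  rewrite card_roots //; congr (_ * nat_of_bool _)%N.
  have -> : (#|E|.-1 %/ (m * R) = v)%N.
    by rewrite -RQ -mv mulnC -mulnA mulnK.
  rewrite expr_div_n -!exprM -rE -/eps.
  rewrite -(inj_eq (mulIf (expf_neq0 r a0))) divfK ?expf_neq0 // mul1r.
  by rewrite eq_sym.
rewrite -RQ -mulr_natr !natrM; ring.
Qed.


Lemma power_sum0 : power_sum psi m 0 = #|E|%:R.
Proof.
rewrite /power_sum (eq_bigr (fun=> 1)) ?sumr_const // => x _.
by rewrite mul0r psi0.
Qed.

End WithCharacter.

Definition affine_points (a b c : E) : {set 'rV[E]_3} :=
  [set v : 'rV[E]_3 | a * v 0 1 ^+ m == b * v 0 0 ^+ m + c * v 0 2%:R ^+ m].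

Lemma sum_rV3_prod (f g h : E -> algC) :
  \sum_(v : 'rV[E]_3) f (v 0 0) * g (v 0 1) * h (v 0 2%:R)
    = (\sum_x f x) * (\sum_x g x) * (\sum_x h x).
Proof.
pose F (i : 'I_3) := nth f [:: f; g; h] i.
transitivity (\prod_(i < 3) \sum_x F i x); last first.
  by rewrite !big_ord_recl big_ord0 mulr1 mulrA.
rewrite bigA_distr_bigA /=.
rewrite (reindex (fun w : {ffun 'I_3 -> E} => \row_i w i)) /=.
  apply: eq_bigr => w _; rewrite !big_ord_recl big_ord0 mulr1 !mxE mulrA.
  by congr (_ * _ * _); congr (_ (w _)); apply: val_inj.
exists (fun v : 'rV[E]_3 => [ffun i => v 0 i]) => w _.
  by apply/ffunP=> i; rewrite ffunE mxE.
by apply/rowP=> i; rewrite mxE ffunE.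
Qed.

(** Detect the equation by orthogonality; the sum over the coordinates then
    factors. *)
Lemma card_affine_points_character (psi : E -> algC) (a b c : E) :
    additive_character psi ->
  #|E|%:R * #|affine_points a b c|%:R
    = \sum_t power_sum psi m (- t * b) * power_sum psi m (t * a)
             * power_sum psi m (- t * c).
Proof.
move=> psi_char; have [psi0 psiD _] := psi_char.
under eq_bigr => t _ do rewrite -sum_rV3_prod.
rewrite exchange_big /= mulr_natr -sumr_const big_mkcond /=.
apply: eq_bigr => v _; rewrite inE.
under eq_bigr => t _ do rewrite -!psiD.
pose d := a * v 0 1 ^+ m - (b * v 0 0 ^+ m + c * v 0 2%:R ^+ m).
rewrite -subr_eq0 -/d -(addchar_sum psi_char); apply: eq_bigr => t _.
by congr psi; rewrite /d; ring.
Qed.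

(** The summand at t != 0 only depends on t^r, and deviates from W^3 only where
    t a, t b or t c lies in the exceptional class. These classes of t coincide
    or not according to the m-th power residue classes of a, b and c. *)
Lemma card_affine_points (a b c : E) : a != 0 -> b != 0 -> c != 0 ->
  #|affine_points a b c|%:R = #|E|%:R ^+ 2 + (#|E|%:R - 1) * W
    * (m%:R * ((a ^+ r == b ^+ r) + (a ^+ r == c ^+ r) + (b ^+ r == c ^+ r))%:R
       - 2 - m%:R ^+ 2 * ((a ^+ r == b ^+ r) && (a ^+ r == c ^+ r))%:R) :> algC.
Proof.
move=> a0 b0 c0.
have [psi psi_char psi_u] := invariant_character_exists u_pchar u_gt1 cardEu.
have Q_neq0 : #|E|%:R != 0 :> algC.
  by rewrite pnatr_eq0 -lt0n ltnW ?finNzRing_gt1.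
apply: (mulfI Q_neq0); rewrite (card_affine_points_character _ _ _ psi_char).
have W2 : W ^+ 2 = #|E|%:R :> algC.
  by rewrite -exprM mulnC exprM sqrrN -exprM -natrX cardEu.
have NX (x t : E) : (- t * x) ^+ r = t ^+ r * x ^+ r.
  by rewrite exprMn exprNn -signr_odd (negbTE r_even) mul1r.
have N0 (t x : E) : t != 0 -> x != 0 -> - t * x != 0.
  by move=> t0 x0; rewrite mulf_neq0 // oppr_eq0.
rewrite (bigD1 0) //= oppr0 !mul0r power_sum0 //.
pose D (x t : E) : algC := (t ^+ r * x ^+ r == eps)%:R.
have term (t : E) : t != 0 ->
  power_sum psi m (- t * b) * power_sum psi m (t * a) * power_sum psi m (- t * c)
  = W ^+ 2 * W * (1 - m%:R * (D a t + D b t + D c t)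
      + m%:R ^+ 2 * ((a ^+ r == b ^+ r)%:R * D a t + (a ^+ r == c ^+ r)%:R * D a t
          + (b ^+ r == c ^+ r)%:R * D b t)
      - m%:R ^+ 3 * ((a ^+ r == b ^+ r) && (a ^+ r == c ^+ r))%:R * D a t).
  move=> t0; rewrite !(power_sum_dvd_norm psi_char) ?N0 ?mulf_neq0 //.
  rewrite !NX exprMn /D; have tr0 : t ^+ r != 0 by rewrite expf_neq0.
  (* t x and t y both exceptional: then x and y are in the same class *)
  have eqD (x y : E) : (t ^+ r * x ^+ r == eps) && (t ^+ r * y ^+ r == eps)
      = (t ^+ r * x ^+ r == eps) && (x ^+ r == y ^+ r).
    by case: eqP => // <-; rewrite (inj_eq (mulfI tr0)) eq_sym.
  have := eqD a b; have := eqD a c; have := eqD b c.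
  case: (t ^+ r * a ^+ r == eps); case: (t ^+ r * b ^+ r == eps);
    case: (t ^+ r * c ^+ r == eps); case: (a ^+ r == b ^+ r);
    case: (a ^+ r == c ^+ r); case: (b ^+ r == c ^+ r) => //= _ _ _;
    rewrite ?mulr1n ?mulr0n; ring.
have mr : (m * r = #|E|.-1)%N by rewrite mulnC divnK.
have r_gt0 : (0 < r)%N by rewrite divn_gt0 // dvdn_leq // card1_gt0.
have epsm : eps ^+ m = 1.
  by rewrite /eps -exprM -mulnA divnK // -signr_odd oddM /= u_odd andbF.
have sumD (x : E) : x != 0 -> \sum_(t : E | t != 0) D x t = r%:R.
  move=> x0; have xr0 : x ^+ r != 0 by rewrite expf_neq0.
  have c1 : eps / x ^+ r != 0.
    by rewrite mulf_neq0 ?invr_eq0 // expf_neq0 // oppr_eq0 oner_eq0.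
  rewrite -natr_sum; congr _%:R.
  transitivity #|[set z : E | z ^+ r == eps / x ^+ r]|.
    rewrite -sum1_card big_mkcond [RHS]big_mkcond /=; apply: eq_bigr => z _.
    rewrite inE (can2_eq (mulfK xr0) (divfK xr0)).
    case: eqVneq => [->|] /=; last by case: eqP.
    by rewrite expr0n gtn_eqF // eq_sym (negbTE c1).
  rewrite card_roots // -[X in (X %/ r)%N]mr mulnK // expr_div_n epsm -exprM.
  by rewrite divnK // expf_card1 // divr1 eqxx muln1.
rewrite (eq_bigr _ term) -mulr_sumr; set eab := _ == _; set eac := _ == _.
set ebc := _ == _.
have -> : \sum_(t : E | t != 0) (1 - m%:R * (D a t + D b t + D c t)
      + m%:R ^+ 2 * (eab%:R * D a t + eac%:R * D a t + ebc%:R * D b t)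
      - m%:R ^+ 3 * (eab && eac)%:R * D a t)
   = #|E|.-1%:R - m%:R * (r%:R + r%:R + r%:R)
     + m%:R ^+ 2 * (eab%:R * r%:R + eac%:R * r%:R + ebc%:R * r%:R)
     - m%:R ^+ 3 * (eab && eac)%:R * r%:R :> algC.
  rewrite !(sumrB, big_split) /= -!mulr_sumr !big_split /= -!mulr_sumr.
  by rewrite !sumD // sumr_const cardC1.
rewrite W2.
have Q1 : #|E|.-1%:R = #|E|%:R - 1 :> algC.
  by rewrite -subn1 natrB // ltnW ?finNzRing_gt1.
have mrC : m%:R * r%:R = #|E|%:R - 1 :> algC by rewrite -natrM mr.
rewrite Q1 -mrC !natrD; move: mrC; move: r%:R m%:R #|E|%:R W => rr mm Q w mrC.
have -> : Q = mm * rr + 1 by rewrite mrC subrK.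
move: (eab%:R) (eac%:R) (ebc%:R) ((eab && eac)%:R) => x y z xy; ring.
Qed.

End DiagonalCount.

(** A projective point has #|E| - 1 coordinate vectors; the last solution is 0. *)
Lemma card_curve_points (F : finFieldType) (a b c : F) (m : nat)
    (L : fieldExtType F) (E := finvect_type L : finFieldType) : (0 < m)%N ->
  #|affine_points m (a%:A : E) (b%:A : E) (c%:A : E)|
    = (#|curve_points a b c m L| * #|E|.-1).+1.
Proof.
move=> m_gt0; set A := affine_points _ _ _ _.
have inA (v : 'rV[E]_3) : (v \in A) = on_curve a b c m v by rewrite inE.
have A0 : 0 \in A.
  by rewrite inE !mxE !expr0n gtn_eqF // !mulr0 addr0 eqxx.
apply: etrans (cardsD1 (0 : 'rV[E]_3) A) _; rewrite A0 add1n; congr _.+1.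
pose D := A :\ 0.
have inD v : (v \in D) = (v != 0) && on_curve a b c m v by rewrite in_setD1 inA.
have scaleA (k : E) v : k != 0 -> (k *: v \in A) = (v \in A).
  move=> k0; rewrite !inE !mxE !exprMn !(mulrCA _ (k ^+ m)) -mulrDr.
  by rewrite (inj_eq (mulfI _)) // expf_neq0.
have scaleD (k : E) v : k != 0 -> (k *: v \in D) = (v \in D).
  by move=> k0; rewrite !in_setD1 scaleA // scaler_eq0 (negbTE k0).
have ppP (v w : 'rV[E]_3) : reflect (exists2 k : E, k != 0 & v = k *: w)
    (v \in @proj_point F L w).
  by apply: (iffP imsetP) => -[k k0 vE]; exists k => //; move: k0; rewrite inE.
have pp_eq (v w : 'rV[E]_3) : (@proj_point F L v == @proj_point F L w)
    = (v \in @proj_point F L w).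
  apply/eqP/ppP=> [e|[k k0 ->]].
    apply/ppP; rewrite -e; apply/ppP; exists 1; rewrite ?oner_eq0 //.
    by rewrite scale1r.
  apply/setP=> z; apply/ppP/ppP=> -[h h0 ->].
    by exists (h * k); rewrite ?mulf_neq0 ?scalerA.
  by exists (h / k); rewrite ?mulf_neq0 ?invr_eq0 // scalerA divfK.
have -> : curve_points a b c m L = [set @proj_point F L v | v in D].
  apply/setP=> P; apply/imsetP/imsetP=> -[v vD ->]; exists v => //.
    by rewrite inD; move: vD; rewrite inE.
  by move: vD; rewrite inD inE.
rewrite -sum1_card (partition_big (@proj_point F L)
    (mem [set @proj_point F L v | v in D])) /=; last first.
  by move=> v vD; apply: imset_f.
rewrite -sum_nat_const; apply: eq_bigr => _ /imsetP[w wD ->].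
transitivity #|@proj_point F L w|.
  rewrite -sum1_card; apply: eq_bigl => v; rewrite pp_eq andb_idl //.
  by case/ppP=> k k0 ->; rewrite scaleD.
rewrite card_in_imset; first by rewrite cardsE; exact: (cardC1 (0 : E)).
move=> k h _ _ /eqP; rewrite -subr_eq0 -scalerBl scaler_eq0 subr_eq0.
move: wD; rewrite in_setD1 => /andP[/negbTE-> _].
by rewrite orbF => /eqP.
Qed.

(** * Counting points over the extensions *)

Lemma ind_mod_div (F : finFieldType) (g : {unit F}) (x y : F) (m i j : int) :
  ind_mod g x m i -> ind_mod g y m j -> ind_mod g (x / y) m (i - j).
Proof.
move=> [k <- ki] [h <- hj]; have g0 : val g != 0.
  by rewrite -unitfE; exact: valP.
exists (k - h); first by rewrite expfzDr // invr_expz.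
apply/eqP; rewrite eqz_mod_dvd opprD addrACA -opprD.
by rewrite rpredB // -eqz_mod_dvd; apply/eqP.
Qed.

Lemma generator_prim_root (F : finFieldType) (g : {unit F}) :
  generator [set: {unit F}] g -> #|F|.-1.-primitive_root (val g).
Proof.
move=> /eqP gen_g; apply/andP; split; first exact: card1_gt0.
have ord_g : #[g]%g = #|F|.-1.
  by rewrite orderE -card_finField_unit; congr #|pred_of_set _|.
have dvd_g e : (val g ^+ e == 1) = (#|F|.-1 %| e)%N.
  by rewrite -val_unitX -ord_g order_dvdn -(inj_eq val_inj).
apply/forallP=> e; rewrite unity_rootE dvd_g.
apply/eqP; apply/idP/eqP=> [Ne|->//].
by apply/eqP; rewrite eqn_leq ltn_ord dvdn_leq.
Qed.

Lemma prim_root_expz (F : fieldType) n (g : F) (e : int) :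
  n.-primitive_root g -> (g ^ e == 1) = (n %| e)%Z.
Proof.
move=> g_prim; rewrite dvdzE (prim_order_dvd g_prim).
by case: e => e //; rewrite NegzE -invr_expz abszN invr_eq1.
Qed.

(** An element of F of index i becomes of index n i, up to a unit, in the
    extension of degree n, because
    (#|F|^n - 1) / (#|F| - 1) = 1 + #|F| + .. + #|F|^(n-1) is congruent to n modulo
    m. *)
Lemma ind_mod_exp_eq1 (F : finFieldType) (g : {unit F}) (x : F) (m : nat) (i : int) n :
    generator [set: {unit F}] g -> ind_mod g x m%:Z i -> (m %| #|F|.-1)%N ->
    (0 < n)%N ->
  (x ^+ ((#|F| ^ n).-1 %/ m) == 1) = (m %| n%:Z * i)%Z.
Proof.
move=> /generator_prim_root g_prim [k <- ki] mF n_gt0.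
have F_gt0 : (0 < #|F|)%N by rewrite ltnW ?finNzRing_gt1.
pose t := (\sum_(j < n) #|F| ^ j)%N; pose v := (#|F|.-1 %/ m)%N.
have vm : (v * m = #|F|.-1)%N by rewrite divnK.
have m_gt0 : (0 < m)%N by apply: dvdn_gt0 mF; exact: card1_gt0.
have v_gt0 : (0 < v)%N by rewrite divn_gt0 // dvdn_leq // card1_gt0.
have -> : ((#|F| ^ n).-1 %/ m = v * t)%N.
  by rewrite predn_exp -vm mulnAC mulnK.
rewrite exprnP exprz_exp (prim_root_expz _ g_prim) -vm !PoszM.
rewrite [k * _]mulrCA [(_ * m%:Z)]mulrC [m%:Z * _]mulrC dvdz_mul2l ?gt_eqF //.
have tn : (m%:Z %| t%:Z - n%:Z)%Z.
  rewrite -eqz_mod_dvd !modz_nat eqz_nat; apply/eqP.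
  transitivity ((\sum_(j < n) 1) %% m)%N; last by rewrite sum1_card card_ord.
  rewrite /t -modn_summ -[RHS]modn_summ.
  congr (_ %% _)%N; apply: eq_bigr => j _.
  rewrite -modnXm -[#|F|](prednK F_gt0) -addn1 -modnDml.
  by rewrite (eqP mF) add0n modnXm exp1n.
have -> : (m %| k * t)%Z = (m %| k * n%:Z)%Z.
  rewrite -[k * t%:Z](subrK (k * n%:Z)) -mulrBr rpredDl //.
  exact: dvdz_mull.
have kin : ((k * n%:Z) %% m = (n%:Z * i) %% m)%Z.
  by rewrite [k * _]mulrC -[LHS]modzMmr ki modzMmr.
by rewrite !(sameP dvdz_mod0P eqP) kin.
Qed.

(** The extension of degree n of F has u^(2 s n) elements. *)
Lemma num_points_diagonal (F : finFieldType) (a b c : F) (g : {unit F})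
    (u s m : nat) (i j : int) (n : nat) :
    [pchar F].-nat u -> odd u -> (1 < u)%N -> (0 < s)%N ->
    #|F| = (u ^ (2 * s))%N -> (m %| u.+1)%N ->
    generator [set: {unit F}] g -> a * b * c != 0 ->
    ind_mod g (b / c) m%:Z i -> ind_mod g (a / c) m%:Z j -> (0 < n)%N ->
  (num_points a b c m n)%:R = #|F|%:R ^+ n + 1 + ((- u%:R) ^+ s) ^+ n
    * (m%:R * ((m %| n%:Z * (j - i))%Z + (m %| n%:Z * j)%Z + (m %| n%:Z * i)%Z)%:R
       - 2 - m%:R ^+ 2 * ((m %| n%:Z * (j - i))%Z && (m %| n%:Z * j)%Z)%:R) :> rat.
Proof.
move=> u_pchar u_odd u_gt1 s_gt0 cardF m_dvd gen_g abc0 ind_i ind_j n_gt0.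
have m_gt0 : (0 < m)%N by case: (m) m_dvd.
have /andP[/andP[a0 b0] c0] : (a != 0) && (b != 0) && (c != 0).
  by move: abc0; rewrite !mulf_eq0 !negb_or.
have mF : (m %| #|F|.-1)%N.
  rewrite cardF expnM predn_exp predn_exp !big_ord_recl big_ord0.
  by rewrite addn0 expn0 expn1 add1n mulnAC dvdn_mull.
have ind_ji : ind_mod g (a / b) m%:Z (j - i).
  have -> : a / b = (a / c) / (b / c) by rewrite invf_div mulrA divfK.
  exact: ind_mod_div.
set L := ext_field F n; pose E : finFieldType := finvect_type L.
have cardE_n : #|E| = (#|F| ^ n)%N by exact: card_ext_field.
have cardE_u : #|E| = (u ^ (2 * (s * n)))%N by rewrite cardE_n cardF -expnM mulnA.
have E_pchar : [pchar E].-nat u.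
  by rewrite (eq_pnat _ (_ : [pchar E] =i [pchar F])) //; apply: pchar_lalg.
have alg0 (x : F) : x != 0 -> (x%:A : E) != 0.
  by move=> x0; rewrite scaler_eq0 negb_or x0 oner_eq0.
have algX (x y : F) r : y != 0 ->
    ((x%:A : E) ^+ r == (y%:A : E) ^+ r) = ((x / y) ^+ r == 1).
  move=> y0; rewrite -(inj_eq (mulIf (expf_neq0 r y0))) mul1r -exprMn divfK //.
  rewrite -[x%:A]/(in_alg L x) -[y%:A]/(in_alg L y) -!rmorphXn.
  exact: (inj_eq (fmorph_inj (in_alg L))).
have sn_gt0 : (0 < s * n)%N by rewrite muln_gt0 s_gt0.
have := card_affine_points E_pchar u_odd u_gt1 sn_gt0 cardE_u m_dvd
  (alg0 _ a0) (alg0 _ b0) (alg0 _ c0).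
rewrite (card_curve_points a b c L m_gt0) !algX // cardE_n.
rewrite (ind_mod_exp_eq1 gen_g ind_ji mF n_gt0).
rewrite (ind_mod_exp_eq1 gen_g ind_j mF n_gt0).
rewrite (ind_mod_exp_eq1 gen_g ind_i mF n_gt0) => count.
apply: (fmorph_inj (@ratr algC)).
rewrite !(rmorphD, rmorphB, rmorphM, rmorphXn, rmorphN, rmorph1, ratr_nat) /=.
rewrite !ratr_nat -exprM.
have Q1 : (#|F| ^ n)%:R - 1 != 0 :> algC.
  rewrite subr_eq0 (eqr_nat _ _ 1) gtn_eqF //.
  by rewrite -[1%N](exp1n n) ltn_exp2r // finNzRing_gt1.
apply: (mulIf Q1); move: count.
have -> : (#|F| ^ n).-1 = (#|F| ^ n - 1)%N by rewrite subn1.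
rewrite -natr1 natrM natrB ?expn_gt0 ?(ltnW (finNzRing_gt1 F)) // natrX => count.
rewrite -[LHS](addrK 1) count; ring.
Qed.

(** * The cyclotomic factors of the zeta numerator *)

(** Exponent vectors turn identities between the products occurring below into
    identities between natural numbers, for lia. *)
Definition mon4 (R : comNzRingType) (x y p q : R) (a b c d : nat) : R :=
  x ^+ a * y ^+ b * p ^+ c * q ^+ d.

Lemma mon4M (R : comNzRingType) (x y p q : R) a b c d a' b' c' d' :
  mon4 x y p q a b c d * mon4 x y p q a' b' c' d'
    = mon4 x y p q (a + a') (b + b') (c + c') (d + d').
Proof. by rewrite /mon4 !exprD; ring. Qed.

Lemma mon4X (R : comNzRingType) (x y p q : R) a b c d n :
  mon4 x y p q a b c d ^+ n = mon4 x y p q (a * n) (b * n) (c * n) (d * n).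
Proof. by rewrite /mon4 !exprMn -!exprM. Qed.

Section Exponents.

Variable l : nat.
Hypothesis l_odd : odd l.

(** The exponent of t in the factor 1 - (w t)^d for an index x modulo 2 l: d is the
    order of x, and p2, pl tell whether 2, l fail to divide x. *)
Definition period (p2 pl : bool) : nat := (2 ^ p2 * l ^ pl)%N.

(** The factors of 1 - (w t)^(2 l): up to sign, the cyclotomic polynomials of
    orders 1, 2, l and 2 l at w t when l is prime. *)
Definition cyc1 (w : int) : {poly int} := 1 - w *: 'X.
Definition cyc2 (w : int) : {poly int} := 1 + w *: 'X.
Definition cycl (w : int) : {poly int} := \sum_(k < l) (w *: 'X) ^+ k.
Definition cyc2l (w : int) : {poly int} := \sum_(k < l) (- (w *: 'X)) ^+ k.

Lemma one_sub_pow_factors (w : int) (p2 pl : bool) :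
  one_sub_pow w (period p2 pl)
    = mon4 (cyc1 w) (cyc2 w) (cycl w) (cyc2l w) 1 p2 pl (p2 && pl).
Proof.
pose x : {poly int} := w *: 'X.
have geo (z : {poly int}) : 1 - z ^+ l = (1 - z) * \sum_(k < l) z ^+ k.
  by rewrite -opprB subrX1 -mulNr opprB.
have geoN : 1 + x ^+ l = (1 + x) * \sum_(k < l) (- x) ^+ k.
  have := geo (- x); rewrite opprK => <-.
  by rewrite exprNn -signr_odd l_odd mulN1r opprK.
rewrite /one_sub_pow /mon4 -exprZn -/x /cyc1 /cyc2 -/x.
case: p2; case: pl;
  rewrite /period ?expn1 ?expn0 ?mul1n ?muln1 ?expr1 ?expr0 ?mulr1 //=.
- rewrite mulnC exprM -[X in _ * X]/(cyc2l w) -[cycl w]/(\sum_(k < l) x ^+ k).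
  rewrite -[RHS]mulrA mulrACA -geo -geoN; ring.
- by ring.
Qed.

(** The exponents 2 l / d and (2 l)^2 / d, for d = period p2 pl. *)
Definition weight (p2 pl : bool) : nat := ((2 - p2) * (if pl then 1 else l))%N.

Definition weight2 (p2 pl : bool) : nat :=
  ((if p2 then 2 else 4) * (if pl then l else l ^ 2))%N.

Lemma weight_period p2 pl : (weight p2 pl * period p2 pl = 2 * l)%N.
Proof. by case: p2; case: pl; rewrite /weight /period ?expn1 ?expn0; lia. Qed.

Lemma weight2_period p2 pl : (weight2 p2 pl * period p2 pl = (2 * l) ^ 2)%N.
Proof. by case: p2; case: pl; rewrite /weight2 /period ?expn1 ?expn0; nia. Qed.

Lemma period_gt0 p2 pl : (0 < period p2 pl)%N.
Proof. by rewrite muln_gt0 !expn_gt0 /=; case: (l) l_odd => //; rewrite orbT. Qed.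

Lemma dvdn_period p2 pl n :
  (period p2 pl %| n)%N = (p2 ==> (2 %| n)%N) && (pl ==> (l %| n)%N).
Proof.
rewrite Gauss_dvd; last by apply: coprimeXl; apply: coprimeXr; rewrite coprime2n.
by case: p2; case: pl; rewrite ?expn1 ?expn0 ?dvd1n.
Qed.

Lemma dvdz_period (n : nat) (x : int) : prime l ->
  ((2 * l)%N %| n%:Z * x)%Z
    = (period (~~ (2 %| x)%Z) (~~ (l %| x)%Z) %| n)%N.
Proof.
move=> l_prime; rewrite dvdn_period !dvdzE abszM /= Gauss_dvd ?coprime2n //.
by rewrite !Euclid_dvdM // !implyNb ![(_ || (_ %| n))%N]orbC.
Qed.

End Exponents.

(** Comparison of the exponents of the four cyclotomic factors on the two sides
    of P * prod_i (1 - (w t)^d_i)^(2 l / d_i) = (1 - w t)^2 (1 - (w t)^d)^((2 l)^2 / d),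
    where d_1, d_2, d_3 are the periods of the indices of a/b, a/c and b/c, and d
    is the least common multiple of d_1 and d_2. *)
Definition weil_numer (l : nat) (p2 q2 r2 pl ql rl : bool) (a0 b0 c0 d0 : nat) : Prop :=
  [/\ (a0 + (weight l p2 pl + weight l q2 ql + weight l r2 rl)
         = 2 + weight2 l (p2 || q2) (pl || ql))%N,
      (b0 + (weight l p2 pl * p2 + weight l q2 ql * q2 + weight l r2 rl * r2)
         = weight2 l (p2 || q2) (pl || ql) * (p2 || q2))%N,
      (c0 + (weight l p2 pl * pl + weight l q2 ql * ql + weight l r2 rl * rl)
         = weight2 l (p2 || q2) (pl || ql) * (pl || ql))%N
    & (d0 + (weight l p2 pl * (p2 && pl) + weight l q2 ql * (q2 && ql)
             + weight l r2 rl * (r2 && rl))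
         = weight2 l (p2 || q2) (pl || ql) * ((p2 || q2) && (pl || ql)))%N].

Section ClassNumber.

Variables (F : finFieldType) (a b c : F) (g : {unit F}) (u s l : nat) (i j : int).
Hypotheses (u_pchar : [pchar F].-nat u) (u_odd : odd u) (u_gt1 : (1 < u)%N).
Hypotheses (s_gt0 : (0 < s)%N) (cardF : #|F| = (u ^ (2 * s))%N).
Hypotheses (l_prime : prime l) (l_odd : odd l) (l_dvd : (2 * l %| u.+1)%N).
Hypotheses (gen_g : generator [set: {unit F}] g) (abc0 : a * b * c != 0).
Hypotheses (ind_i : ind_mod g (b / c) (2 * l)%N%:Z i).
Hypotheses (ind_j : ind_mod g (a / c) (2 * l)%N%:Z j).

Local Notation np2 x := (~~ (2 %| x)%Z).
Local Notation npl x := (~~ (l %| x)%Z).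

(** The condition 2 l | n x in the point count reads: the period of x divides n.
    This makes the count a combination of power sums of roots of unity times
    w^n. *)
Lemma zeta_numerator_diagonal (a0 b0 c0 d0 : nat) (w := (- u%:Z) ^+ s) :
    weil_numer l (np2 (j - i)) (np2 j) (np2 i) (npl (j - i)) (npl j) (npl i)
      a0 b0 c0 d0 ->
  zeta_numerator a b c (2 * l)
    (mon4 (cyc1 w) (cyc2 w) (cycl l w) (cyc2l l w) a0 b0 c0 d0).
Proof.
move=> [ea eb ec ed]; set P := mon4 _ _ _ _ _ _ _ _.
set p2 := np2 (j - i); set q2 := np2 j; set r2 := np2 i.
set pl := npl (j - i); set ql := npl j; set rl := npl i.
pose o p q : {poly int} := one_sub_pow w (period l p q).
have id_P : P * (o p2 pl ^+ weight l p2 pl * o q2 ql ^+ weight l q2 ql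
                 * o r2 rl ^+ weight l r2 rl)
    = one_sub_pow w 1 ^+ 2
      * o (p2 || q2) (pl || ql) ^+ weight2 l (p2 || q2) (pl || ql).
  rewrite -[1%N]/(period l false false) /o !one_sub_pow_factors // !mon4X !mon4M.
  by congr mon4; rewrite ?mul1n ?mul0n ?add0n ?[((_ : bool) * _)%N]mulnC
    ?ea ?eb ?ec ?ed // ?[(weight _ _ _ * _)%N]mulnC.
have pos p q : (0 < period l p q)%N by exact: period_gt0.
(* keeps the morphism lemmas from looking inside P *)
clearbody P.
have := congr1 (map_poly (intr : int -> rat)) id_P.
rewrite !(rmorphM, rmorphXn) /= /o !map_one_sub_pow => id_Pq.
have ratio n :=
  logder_ratio_of_products n (pos _ _) (pos _ _) (pos _ _) (pos _ _) id_Pq.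
apply: zeta_numeratorP.
  have [P0 _] := ratio 0%N; apply: (@intr_inj rat).
  by move: P0; rewrite coef_map.
move=> n; have [_] := ratio n; congr (logder _ _ _).
apply/polyP=> k; rewrite !coef_poly; case: ifP => // _.
rewrite (num_points_diagonal u_pchar u_odd u_gt1 s_gt0 cardF l_dvd gen_g abc0
  ind_i ind_j (ltn0Sn k)).
rewrite (weight2_period l_odd) !(weight_period l_odd) !(dvdz_period l_odd _ _ l_prime).
rewrite -/p2 -/q2 -/r2 -/pl -/ql -/rl.
have -> : (period l (p2 || q2) (pl || ql) %| k.+1)%N
    = (period l p2 pl %| k.+1)%N && (period l q2 ql %| k.+1)%N.
  rewrite !dvdn_period //.
  by case: (p2); case: (q2); case: (pl); case: (ql); case: (2 %| _)%N;
     case: (l %| _)%N.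
have -> : w%:~R = (- u%:R) ^+ s :> rat by rewrite rmorphXn rmorphN /=.
rewrite -!mulnDr !natrM; ring.
Qed.

End ClassNumber.

(** * The value of the zeta numerator at 1 *)

Section Values.
Variables (u s l : nat).
Hypotheses (u_gt1 : (1 < u)%N) (s_gt0 : (0 < s)%N) (l_odd : odd l).

(** The opposite of the sign of w = (- u)^s. With it the two parities of s are
    treated at once: norm1B, norm1D, norm1Bl, norm1Dl are the absolute values of
    1 - w, 1 + w, 1 - w^l, 1 + w^l. *)
Definition sgn : rat := if odd s then 1 else -1.
Definition norm1B : rat := u%:R ^+ s + sgn.
Definition norm1D : rat := u%:R ^+ s - sgn.
Definition norm1Bl : rat := u%:R ^+ (l * s) + sgn.
Definition norm1Dl : rat := u%:R ^+ (l * s) - sgn.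

Lemma sgn_sqr : sgn * sgn = 1.
Proof. by rewrite /sgn; case: odd; rewrite ?mulrNN mulr1. Qed.

Lemma upow_gt1 n : (0 < n)%N -> 1 < u%:R ^+ n :> rat.
Proof. by case: n => // n _; rewrite exprn_egt1 ?(ltr_nat _ 1). Qed.

Lemma upow_sgn n : (0 < n)%N -> (0 < u%:R ^+ n + sgn) && (0 < u%:R ^+ n - sgn).
Proof.
move=> /upow_gt1 n1; have n0 := lt_trans ltr01 n1.
by rewrite /sgn; case: odd; rewrite ?opprK subr_gt0 n1 addr_gt0.
Qed.

Lemma norm1B_gt0 : 0 < norm1B. Proof. by case/andP: (upow_sgn s_gt0). Qed.
Lemma norm1D_gt0 : 0 < norm1D. Proof. by case/andP: (upow_sgn s_gt0). Qed.
Lemma ls_gt0 : (0 < l * s)%N.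
Proof. by rewrite muln_gt0 s_gt0 andbT; case: (l) l_odd. Qed.
Lemma norm1Bl_gt0 : 0 < norm1Bl. Proof. by case/andP: (upow_sgn ls_gt0). Qed.
Lemma norm1Dl_gt0 : 0 < norm1Dl. Proof. by case/andP: (upow_sgn ls_gt0). Qed.

Let w : int := (- u%:Z) ^+ s.

Lemma w_rat : w%:~R = - sgn * u%:R ^+ s :> rat.
Proof.
rewrite rmorphXn rmorphN /= exprNn -signr_odd /sgn.
by case: odd; rewrite ?opprK.
Qed.

Lemma w_rat_exp : w%:~R ^+ l = - sgn * u%:R ^+ (l * s) :> rat.
Proof.
rewrite w_rat exprMn -exprM [(s * l)%N]mulnC; congr (_ * _).
rewrite /sgn exprNn -signr_odd l_odd expr1 mulN1r; congr (- _).
by case: odd; rewrite ?expr1n // -signr_odd l_odd.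
Qed.

Lemma eval_factors (f := fun p : {poly int} => (p.[1])%:~R : rat) :
  [/\ f (cyc1 w) = sgn * norm1B, f (cyc2 w) = - sgn * norm1D,
      f (cycl l w) = norm1Bl / norm1B & f (cyc2l l w) = norm1Dl / norm1D].
Proof.
have x0 := lt0r_neq0 norm1B_gt0; have y0 := lt0r_neq0 norm1D_gt0.
have sgn0 : sgn != 0.
  by apply/eqP=> s0; have := sgn_sqr; rewrite s0 mul0r => /eqP; rewrite eq_sym oner_eq0.
have E1 : f (cyc1 w) = 1 - w%:~R.
  by rewrite /f hornerD hornerN hornerZ hornerX hornerC mulr1 rmorphB.
have E2 : f (cyc2 w) = 1 + w%:~R.
  by rewrite /f hornerD hornerZ hornerX hornerC mulr1 rmorphD.
have geo (z : rat) : (1 - z) * \sum_(k < l) z ^+ k = 1 - z ^+ l.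
  by rewrite -[1 - z ^+ l]opprB subrX1 -mulNr opprB.
have L1 : f (cycl l w) = \sum_(k < l) w%:~R ^+ k.
  rewrite /f horner_sum rmorph_sum; apply: eq_bigr => k _.
  by rewrite horner_exp hornerZ hornerX mulr1 rmorphXn.
have L2 : f (cyc2l l w) = \sum_(k < l) (- w%:~R) ^+ k.
  rewrite /f horner_sum rmorph_sum; apply: eq_bigr => k _.
  by rewrite horner_exp hornerN hornerZ hornerX mulr1 rmorphXn rmorphN.
have E1s : 1 - w%:~R = sgn * norm1B.
  by rewrite w_rat /norm1B mulrDr sgn_sqr; ring.
have E2s : 1 + w%:~R = - sgn * norm1D.
  by rewrite w_rat /norm1D mulrBr [- sgn * sgn]mulNr sgn_sqr; ring.
split; rewrite ?E1 ?E2 ?L1 ?L2 //.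
- apply: (mulfI (_ : sgn * norm1B != 0)); first by rewrite mulf_neq0.
  rewrite -{1}E1s geo w_rat_exp -mulrA [norm1B * _]mulrC divfK //.
  by rewrite /norm1Bl mulrDr sgn_sqr; ring.
- apply: (mulfI (_ : - sgn * norm1D != 0)); first by rewrite mulf_neq0 // oppr_eq0.
  rewrite -{1}E2s -[X in (1 + X) * _]opprK geo exprNn -signr_odd l_odd expr1 mulN1r.
  rewrite opprK w_rat_exp -mulrA [norm1D * _]mulrC divfK //.
  by rewrite /norm1Dl mulrBr [- sgn * sgn]mulNr sgn_sqr; ring.
Qed.

(** Even exponents dispose of the signs of 1 - w and 1 + w; the other two factors
    are positive at 1. *)
Lemma mon4_eval a b c d : ~~ odd a -> ~~ odd b ->
  ((mon4 (cyc1 w) (cyc2 w) (cycl l w) (cyc2l l w) a b c d).[1])%:~R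
    = mon4 norm1B norm1D (norm1Bl / norm1B) (norm1Dl / norm1D) a b c d.
Proof.
move=> a_even b_even; have [e1 e2 l1 l2] := eval_factors.
rewrite /mon4 !hornerM !horner_exp !rmorphM !rmorphXn /= e1 e2 l1 l2.
have even_sgn n : ~~ odd n -> sgn ^+ n = 1.
  move=> n_even; rewrite -(odd_double_half n) (negbTE n_even) add0n -mul2n.
  by rewrite exprM expr2 sgn_sqr expr1n.
rewrite !exprMn even_sgn // mul1r exprNn -signr_odd (negbTE b_even) mul1r.
by rewrite even_sgn // mul1r.
Qed.

Lemma mon4_class_ge0 a b c d :
  0 <= mon4 norm1B norm1D (norm1Bl / norm1B) (norm1Dl / norm1D) a b c d.
Proof.
have x0 := ltW norm1B_gt0; have y0 := ltW norm1D_gt0.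
have X0 := ltW norm1Bl_gt0; have Y0 := ltW norm1Dl_gt0.
by rewrite /mon4 !mulr_ge0 ?exprn_ge0 // divr_ge0.
Qed.

Lemma class_number_eval (F : finFieldType) (al be ga : F) a b c d :
    ~~ odd a -> ~~ odd b ->
    zeta_numerator al be ga (2 * l)
      (mon4 (cyc1 w) (cyc2 w) (cycl l w) (cyc2l l w) a b c d) ->
  exists2 h, class_number al be ga (2 * l) h
    & h%:R = mon4 norm1B norm1D (norm1Bl / norm1B) (norm1Dl / norm1D) a b c d :> rat.
Proof.
move=> a_even b_even zP; set P := mon4 _ _ _ _ _ _ _ _ in zP.
have PE : (P.[1])%:~R = _ := mon4_eval c d a_even b_even.
have P_ge0 : 0 <= P.[1] by rewrite -(ler0z rat) PE mon4_class_ge0.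
exists `|P.[1]|%N; first by exists P; rewrite // gez0_abs.
by rewrite -PE -[in RHS](gez0_abs P_ge0).
Qed.

End Values.

(** * The exponents and the residues of the indices *)

Section Residues.
Variable l : nat.
Hypothesis l_odd : odd l.
Local Notation m := ((2 * l)%N%:Z).

Lemma dvdz_double (x : int) : (m %| x)%Z = (2 %| x)%Z && (l %| x)%Z.
Proof. by rewrite !dvdzE /= Gauss_dvd ?coprime2n. Qed.

Lemma eqz_mod_double (x y : int) :
  (x == y %[mod m])%Z = (2 %| x - y)%Z && (l %| x - y)%Z.
Proof. by rewrite eqz_mod_dvd dvdz_double. Qed.

Lemma eqz_mod_double0 (x : int) :
  (x == 0 %[mod m])%Z = (2 %| x)%Z && (l %| x)%Z.
Proof. by rewrite eqz_mod_double subr0. Qed.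

Lemma eqz_mod_doublel (x : int) :
  (x == l %[mod m])%Z = ~~ (2 %| x)%Z && (l %| x)%Z.
Proof.
rewrite eqz_mod_double; congr (_ && _); first by lia.
by rewrite rpredDr // rpredN dvdzz.
Qed.

End Residues.

Lemma eqz_mod2 (x y : int) : (x == y %[mod 2])%Z = ((2 %| x)%Z == (2 %| y)%Z).
Proof. by lia. Qed.

Lemma dvdz_subC d (x y : int) : (d %| x - y)%Z = (d %| y - x)%Z.
Proof. by rewrite -opprB rpredN. Qed.

Lemma dvdz2_sub (x y : int) : (2 %| x - y)%Z = ((2 %| x)%Z == (2 %| y)%Z).
Proof. lia. Qed.

Lemma dvdz_sub_consistent (d : int) (x y : int) :
  [&& (d %| x)%Z ==> ((d %| x - y)%Z == (d %| y)%Z)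
    & (d %| y)%Z ==> ((d %| x - y)%Z == (d %| x)%Z)].
Proof.
apply/andP; split; apply/implyP=> dx; apply/eqP.
  by rewrite rpredDl // rpredN.
by rewrite rpredDr // rpredN.
Qed.

Section Expo.
Variable (l : nat) (p2 q2 r2 pl ql rl : bool).
Let e := weight2 l (p2 || q2) (pl || ql).
Let ep := weight l p2 pl.
Let eq_ := weight l q2 ql.
Let er := weight l r2 rl.
Definition expo1 := (2 + e - (ep + eq_ + er))%N.
Definition expo2 := (e * (p2 || q2) - (ep * p2 + eq_ * q2 + er * r2))%N.
Definition expol := (e * (pl || ql) - (ep * pl + eq_ * ql + er * rl))%N.
Definition expo2l := (e * ((p2 || q2) && (pl || ql))
   - (ep * (p2 && pl) + eq_ * (q2 && ql) + er * (r2 && rl)))%N.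

(** The constraints that the divisibility by 2 and by l of j and i put on
    j - i. *)
Definition consistent :=
  [&& p2 == q2 (+) r2, ~~ ql ==> (pl == rl) & ~~ rl ==> (pl == ql)].

(** For consistent data none of the subtractions defining the exponents is
    truncated: P is a polynomial. *)
Lemma expo_weil : (2 < l)%N -> odd l -> consistent ->
  [/\ weil_numer l p2 q2 r2 pl ql rl expo1 expo2 expol expo2l,
      ~~ odd expo1 & ~~ odd expo2].
Proof.
rewrite /expo1 /expo2 /expol /expo2l /e /ep /eq_ /er /consistent /weil_numer.
rewrite /weight /weight2 => l_gt2 l_odd.
have -> : l = (2 * (l./2).-1 + 3)%N by lia.
move: (l./2).-1 => t.
case: p2; case: q2; case: r2; case: pl; case: ql; case: rl => //= _;
  rewrite ?(muln0, mul0n, muln1, mul1n, addn0, add0n, subn0, subnn, expnS, expn0);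
  split; try split; nia.
Qed.

End Expo.

(** * The class number *)

(** u = p^(f/2) is congruent to -1 modulo l: its square is congruent to 1 while u
    is not, by minimality of f. *)
Lemma semiprimitive_sqrt (p l f u : nat) :
    prime p -> odd p -> prime l -> odd l -> is_ord p l f -> ~~ odd f ->
    (u ^ 2 = p ^ f)%N ->
  [/\ u = (p ^ f./2)%N, odd u, (1 < u)%N & (2 * l %| u.+1)%N].
Proof.
move=> p_prime p_odd l_prime l_odd [_ f_gt0 pf f_min] f_even u2.
have fE : f = (2 * f./2)%N by rewrite mul2n -[LHS]odd_double_half (negbTE f_even).
have f2_gt0 : (0 < f./2)%N by lia.
have uE : u = (p ^ f./2)%N.
  by apply/eqP; rewrite -(@eqn_exp2r _ _ 2) // u2 -expnM mulnC -fE.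
have u_odd : odd u by rewrite uE oddX p_odd orbT.
have u_gt1 : (1 < u)%N by rewrite uE -(exp1n f./2) ltn_exp2r // prime_gt1.
split=> //; rewrite Gauss_dvd ?coprime2n // dvdn2 /= u_odd /=.
have : (l %| (u ^ 2).-1)%N.
  by rewrite -subn1 -eqn_mod_dvd ?expn_gt0 ?(ltnW u_gt1) // u2; apply/eqP.
rewrite predn_exp !big_ord_recl big_ord0 addn0 expn0 expn1 add1n Euclid_dvdM //.
case/orP=> //; rewrite -subn1 -eqn_mod_dvd ?(ltnW u_gt1) // uE => /eqP.
by move=> /(f_min _ f2_gt0); lia.
Qed.

(** The closed forms, one for each multiset of periods of j - i, j and i, with
    m = 2 l in the names. Here x, y, X, Y stand for the absolute values of 1 - w,
    1 + w, 1 - w^l, 1 + w^l. *)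
Section ValueForms.

Variables (K : fieldType) (x y X Y : K).
Hypotheses (x0 : x != 0) (y0 : y != 0).
Local Notation mon := (mon4 x y (X / x) (Y / y)).

Lemma mon4_x n : x ^+ n = mon n 0 0 0.
Proof. by rewrite /mon4 !expr0 !mulr1. Qed.
Lemma mon4_y n : y ^+ n = mon 0 n 0 0.
Proof. by rewrite /mon4 !expr0 !mulr1 mul1r. Qed.
Lemma mon4_X n : X ^+ n = mon n 0 n 0.
Proof. by rewrite /mon4 !expr0 !mulr1 -exprMn mulrCA divff ?mulr1. Qed.
Lemma mon4_Y n : Y ^+ n = mon 0 n 0 n.
Proof. by rewrite /mon4 !expr0 mul1r mulr1 -exprMn mulrCA divff ?mulr1. Qed.
Definition mon4E := (mon4_x, mon4_y, mon4_X, mon4_Y, mon4M).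

Lemma mon4_frac a b c d N M : M != 0 -> mon a b c d * M = N -> mon a b c d = N / M.
Proof. by move=> M0 <-; rewrite mulfK. Qed.

Lemma mon4_periods_122 a b : mon a b 0 0 = x ^+ a * y ^+ b.
Proof. by rewrite !mon4E; congr mon4; lia. Qed.

Variable l : nat.
Hypothesis l_gt2 : (2 < l)%N.

Lemma mon4_periods_lll : mon (4 * l - 4) 0 (4 * l - 6) 0 = x ^+ 2 * X ^+ (4 * l - 6).
Proof. by rewrite !mon4E; congr mon4; lia. Qed.
Lemma mon4_periods_1ll : mon (2 * l - 2) 0 (4 * l - 4) 0
  = X ^+ (4 * l - 4) / x ^+ (2 * l - 2).
Proof. by apply: mon4_frac; rewrite ?expf_neq0 // !mon4E; congr mon4; lia. Qed.
Lemma mon4_periods_1mm : mon 0 (2 * l - 2) (2 * l - 2) (2 * l - 2)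
  = ((X * Y) / x) ^+ (2 * l - 2).
Proof.
rewrite expr_div_n exprMn; apply: mon4_frac; rewrite ?expf_neq0 //.
by rewrite !mon4E; congr mon4; lia.
Qed.
Lemma mon4_periods_lmm : mon (2 * l - 2) (2 * l - 2) (2 * l - 4) (2 * l - 2)
  = x ^+ 2 * X ^+ (2 * l - 4) * Y ^+ (2 * l - 2).
Proof. by rewrite !mon4E; congr mon4; lia. Qed.
Lemma mon4_periods_2lm : mon (l - 1) (l - 1) (2 * l - 3) (2 * l - 1)
  = X ^+ (2 * l - 3) * Y ^+ (2 * l - 1) / (x ^+ (l - 2) * y ^+ l).
Proof.
apply: mon4_frac; rewrite ?mulf_neq0 ?expf_neq0 //.
by rewrite !mon4E; congr mon4; lia.
Qed.

End ValueForms.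

Ltac sgn_cases :=
  rewrite /norm1B /norm1D /norm1Bl /norm1Dl /sgn; case: odd; rewrite ?opprK.

Ltac split_false :=
  match goal with
  | X : is_true false |- _ => discriminate X
  | X : _ /\ _ |- _ => destruct X
  | X : _ \/ _ |- _ => destruct X
  | X : and3 _ _ _ |- _ => destruct X
  | X : and4 _ _ _ _ |- _ => destruct X
  | X : and5 _ _ _ _ _ |- _ => destruct X
  | X : or3 _ _ _ |- _ => destruct X
  end.

(** The hypothesis H on i and j is expressed through the divisibility by 2 and l
    of i, j and j - i, named A, B, C, D, G below, and the exponents are compared
    in each of the combinations that satisfy H and the constraint con. *)
Ltac exponents l_gt2 l_odd i j A B C D G con H :=
  move: con H;
  rewrite ?(eqz_mod_double0 l_odd) ?(eqz_mod_doublel l_odd) ?(eqz_mod_double l_odd)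
    ?eqz_mod2 ?(dvdz_subC _ i j) ?dvdz2_sub ?dvdz0 -/A -/B -/C -/D -/G;
  move: (A) (B) (C) (D) (G); clear - l_gt2 l_odd;
  rewrite /expo1 /expo2 /expol /expo2l /weight /weight2;
  case; case; case; case; case => //= _; rewrite ?eqxx ?eqb_id ?eqbF_neg //=;
  try (let X := fresh in intro X; solve [repeat split_false]);
  move=> _; rewrite ?(muln0, mul0n, muln1, mul1n, subn0, sub0n);
  congr mon4; nia.

Theorem theorem2 (p l f s u : nat) (F : finFieldType) (a b c : F)
    (gamma : {unit F}) (i j : int)
    (p_prime : prime p) (p_odd : odd p) (l_prime : prime l) (l_odd : odd l)
    (ord_f : is_ord p l f) (f_even : ~~ odd f) (s_ge1 : (1 <= s)%N)
    (card_F : #|F| = (p ^ (f * s))%N) (u_sqrt : (u ^ 2 = p ^ f)%N)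
    (abc_neq0 : a * b * c != 0)
    (gen_gamma : generator [set: {unit F}] gamma)
    (ind_i : ind_mod gamma (b / c) (2 * l)%N%:Z i)
    (ind_j : ind_mod gamma (a / c) (2 * l)%N%:Z j) :
  let m : int := (2 * l)%N%:Z in
  let U : rat := u%:R in
  exists2 h : nat, class_number a b c (2 * l) h &
  [/\ (* case 1 *)
      ((i == 0 %[mod m])%Z /\ (j == 0 %[mod m])%Z ->
       h%:R = if odd s then (U ^+ s + 1) ^+ ((2 * l - 1) * (2 * l - 2))
              else (U ^+ s - 1) ^+ ((2 * l - 1) * (2 * l - 2))),
      (* case 2 *)
      ([/\ (i == 0 %[mod 2])%Z, (j == 0 %[mod 2])%Z, (i != 0 %[mod m])%Z,
           (j != 0 %[mod m])%Z & (i - j != 0 %[mod m])%Z] ->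
       h%:R = if odd s
              then (U ^+ s + 1) ^+ 2 * (U ^+ (l * s) + 1) ^+ (4 * l - 6)
              else (U ^+ s - 1) ^+ 2 * (U ^+ (l * s) - 1) ^+ (4 * l - 6)),
      (* case 3 *)
      ([/\ (i == 0 %[mod 2])%Z, (j == 0 %[mod 2])%Z &
           [\/ (i == 0 %[mod m])%Z /\ (j != 0 %[mod m])%Z,
               (i != 0 %[mod m])%Z /\ (j == 0 %[mod m])%Z
             | [/\ (i != 0 %[mod m])%Z, (j != 0 %[mod m])%Z
                 & (i == j %[mod m])%Z]]] ->
       h%:R = if odd s
              then (U ^+ (l * s) + 1) ^+ (4 * l - 4)
                   / (U ^+ s + 1) ^+ (2 * l - 2)
              else (U ^+ (l * s) - 1) ^+ (4 * l - 4)
                   / (U ^+ s - 1) ^+ (2 * l - 2))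
    & [/\ (* case 4 *)
      ([\/ (i == 0 %[mod m])%Z /\ (j == l %[mod m])%Z,
           (i == l %[mod m])%Z /\ (j == 0 %[mod m])%Z
         | (i == j %[mod m])%Z /\ (j == l %[mod m])%Z] ->
       h%:R = if odd s
              then (U ^+ s + 1) ^+ (2 * (l - 1) ^ 2)
                   * (U ^+ s - 1) ^+ (2 * l * (l - 1))
              else (U ^+ s - 1) ^+ (2 * (l - 1) ^ 2)
                   * (U ^+ s + 1) ^+ (2 * l * (l - 1))),
      (* case 5 *)
      ([\/ [/\ (j != 0 %[mod 2])%Z, (i == 0 %[mod m])%Z
             & (j != l %[mod m])%Z],
           [/\ (i != 0 %[mod 2])%Z, (i != l %[mod m])%Z
             & (j == 0 %[mod m])%Z]
         | [/\ (i != 0 %[mod 2])%Z, (i == j %[mod m])%Z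
             & (i != l %[mod m])%Z]] ->
       h%:R = if odd s
              then ((U ^+ (2 * l * s) - 1) / (U ^+ s + 1)) ^+ (2 * l - 2)
              else ((U ^+ (2 * l * s) - 1) / (U ^+ s - 1)) ^+ (2 * l - 2)),
      (* case 6 *)
      ([/\ (i != 0 %[mod m])%Z && (i != l %[mod m])%Z,
           (j != 0 %[mod m])%Z && (j != l %[mod m])%Z,
           (i - j != 0 %[mod m])%Z && (i - j != l %[mod m])%Z
         & (i != j %[mod 2])%Z
           \/ (i != 0 %[mod 2])%Z /\ (j != 0 %[mod 2])%Z] ->
       h%:R = if odd s
              then (U ^+ s + 1) ^+ 2 * (U ^+ (l * s) + 1) ^+ (2 * l - 4)
                   * (U ^+ (l * s) - 1) ^+ (2 * l - 2)
              else (U ^+ s - 1) ^+ 2 * (U ^+ (l * s) - 1) ^+ (2 * l - 4)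
                   * (U ^+ (l * s) + 1) ^+ (2 * l - 2))
      (* case 7 *)
    & ([\/ (i == l %[mod m])%Z
             /\ (j != 0 %[mod m])%Z && (j != l %[mod m])%Z,
           (i != 0 %[mod m])%Z && (i != l %[mod m])%Z
             /\ (j == l %[mod m])%Z
         | [/\ (i != 0 %[mod m])%Z && (i != l %[mod m])%Z,
               (j != 0 %[mod m])%Z && (j != l %[mod m])%Z
             & (i - j == l %[mod m])%Z]] ->
       h%:R = if odd s
              then (U ^+ (l * s) + 1) ^+ (2 * l - 3)
                   * (U ^+ (l * s) - 1) ^+ (2 * l - 1)
                   / ((U ^+ s + 1) ^+ (l - 2) * (U ^+ s - 1) ^+ l)
              else (U ^+ (l * s) - 1) ^+ (2 * l - 3)
                   * (U ^+ (l * s) + 1) ^+ (2 * l - 1)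
                   / ((U ^+ s - 1) ^+ (l - 2) * (U ^+ s + 1) ^+ l))]].
Proof.
move=> m U.
have [uE u_odd u_gt1 l_dvd] :=
  semiprimitive_sqrt p_prime p_odd l_prime l_odd ord_f f_even u_sqrt.
have u_pchar : [pchar F].-nat u.
  have pF := card_finPcharP card_F p_prime.
  by rewrite uE (eq_pnat _ (pcharf_eq pF)) pnatX pnat_id.
have cardFu : #|F| = (u ^ (2 * s))%N by rewrite card_F !expnM u_sqrt.
have l_gt2 : (2 < l)%N.
  by rewrite ltn_neqAle prime_gt1 // andbT; apply: contraTneq l_odd => <-.
pose A := (2 %| i)%Z; pose B := (2 %| j)%Z.
pose C := (l %| i)%Z; pose D := (l %| j)%Z; pose G := (l %| j - i)%Z.
have con : (D ==> (G == C)) && (C ==> (G == D)) := dvdz_sub_consistent l j i.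
have np_sub : ~~ (2 %| j - i)%Z = ~~ (B == A) by rewrite dvdz2_sub.
have consist : consistent (~~ (B == A)) (~~ B) (~~ A) (~~ G) (~~ D) (~~ C).
  move: con; rewrite /consistent.
  by case: (A); case: (B); case: (C); case: (D); case: (G).
have [weil even1 even2] := expo_weil l_gt2 l_odd consist.
have zP := zeta_numerator_diagonal u_pchar u_odd u_gt1 s_ge1 cardFu l_prime l_odd
  l_dvd gen_gamma abc_neq0 ind_i ind_j.
rewrite np_sub in zP.
have [h ch hE] := class_number_eval u_gt1 s_ge1 l_odd even1 even2 (zP _ _ _ _ weil).
have x0 := lt0r_neq0 (norm1B_gt0 u_gt1 s_ge1).
have y0 := lt0r_neq0 (norm1D_gt0 u_gt1 s_ge1).
have XY : U ^+ (2 * l * s) - 1 = norm1Bl u s l * norm1Dl u s l.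
  rewrite -mulnA mulnC exprM /norm1Bl /norm1Dl -/U -(sgn_sqr s); ring.
exists h => //; rewrite hE; split; last split.
- move=> H; transitivity (norm1B u s ^+ ((2 * l - 1) * (2 * l - 2)));
    last by sgn_cases.
  rewrite (mon4_x _ (norm1D u s) (norm1Bl u s l) (norm1Dl u s l)).
  exponents l_gt2 l_odd i j A B C D G con H.

- move=> H; transitivity (norm1B u s ^+ 2 * norm1Bl u s l ^+ (4 * l - 6));
    last by sgn_cases.
  rewrite -(@mon4_periods_lll _ _ (norm1D u s) _ (norm1Dl u s l)) //.
  exponents l_gt2 l_odd i j A B C D G con H.
- move=> H.
  transitivity (norm1Bl u s l ^+ (4 * l - 4) / norm1B u s ^+ (2 * l - 2));
    last by sgn_cases.
  rewrite -(@mon4_periods_1ll _ _ (norm1D u s) _ (norm1Dl u s l)) //.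
  exponents l_gt2 l_odd i j A B C D G con H.
- move=> H.
  transitivity (norm1B u s ^+ (2 * (l - 1) ^ 2) * norm1D u s ^+ (2 * l * (l - 1)));
    last by sgn_cases.
  rewrite -(@mon4_periods_122 _ _ _ (norm1Bl u s l) (norm1Dl u s l)) //.
  exponents l_gt2 l_odd i j A B C D G con H.
- move=> H.
  transitivity ((norm1Bl u s l * norm1Dl u s l / norm1B u s) ^+ (2 * l - 2));
    last first.
    by rewrite XY; sgn_cases.
  rewrite -(@mon4_periods_1mm _ _ (norm1D u s)) //.
  exponents l_gt2 l_odd i j A B C D G con H.
- move=> H.
  transitivity (norm1B u s ^+ 2 * norm1Bl u s l ^+ (2 * l - 4)
    * norm1Dl u s l ^+ (2 * l - 2));
    last by sgn_cases.
  rewrite -(@mon4_periods_lmm _ _ (norm1D u s)) //.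
  exponents l_gt2 l_odd i j A B C D G con H.
- move=> H.
  transitivity (norm1Bl u s l ^+ (2 * l - 3) * norm1Dl u s l ^+ (2 * l - 1)
    / (norm1B u s ^+ (l - 2) * norm1D u s ^+ l));
    last by sgn_cases.
  rewrite -mon4_periods_2lm //.
  exponents l_gt2 l_odd i j A B C D G con H.
Qed.
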